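(* Assume Condition C holds and the walk is transient to the right, $X_n\to+\infty$ (i.e. $\xi_n\to+\infty$) $\mathbb{P}^\mu$-a.s., where the initial distribution is $P_\omega^\mu(\xi_0=0,\,Y_0=i)=\mu_\omega(i)=\mathbf{y}_{-1}(i)$, $i\in\mathscr{D}$, for $P$-a.e. $\omega$. Assume in addition that $v_p>0$. Then for each $i\in\mathscr{D}$, $Q_i(\cdot)$ is absolutely continuous with respect to $P$, and so is $\overline{Q}(\cdot)$. The densities are given by $$\frac{dQ_i}{dP}=\Lambda_\omega^{(i)},\qquad \Lambda_\omega^{(i)}=v_p\big[\mu_\omega\big(\widetilde{u}_0+\zeta_0A_1\widetilde{u}_0+\zeta_0\zeta_1A_2A_1\widetilde{u}_0+\cdots\big)\big](i),$$ and $$\frac{d\overline{Q}}{dP}=\Lambda_\omega,\qquad \Lambda_\omega=v_p\big[\mu_\omega\big(\widetilde{u}_0+\zeta_0A_1\widetilde{u}_0+\zeta_0\zeta_1A_2A_1\widetilde{u}_0+\cdots\big)\big]\mathbf{1},$$ where the general term of the series is $\zeta_0\zeta_1\cdots\zeta_{k-1}A_kA_{k-1}\cdots A_1\widetilde{u}_0$, $k\ge0$.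
   Context: Environment. Fix an integer $d\ge1$, $\mathscr{D}=\{1,\dots,d\}$. $(P_n,Q_n,R_n)_{n\in\mathbb{Z}}$ is a strictly stationary ergodic sequence of triples of $d\times d$ matrices with non-negative entries such that $P_n+Q_n+R_n$ is stochastic for every $n$. $\Omega$ is the space of all sequences $\omega=(\omega_n)=((P_n,Q_n,R_n))_{n\in\mathbb{Z}}$ of such triples, $\mathscr{F}$ its natural $\sigma$-algebra, $P$ the law of the sequence, $E$ its expectation, and $\theta$ the shift, $(\theta\omega)_n=\omega_{n+1}$. $I$ is the identity matrix, $\mathbf{1}$ is the all-ones column vector, and $\|A\|=\max_i\sum_j|a(i,j)|$ for a matrix $A=(a(i,j))$. Walk. Given $\omega$ and a family $\mu=(\mu_\omega)$ of probability (row) vectors on $\mathscr{D}$, the quenched law $P_\omega^\mu$ is that of the time-homogeneous Markov chain $X_n=(\xi_n,Y_n)$, $n\ge0$, on $S=\mathbb{Z}\times\mathscr{D}$ with $\xi_0=0$, $Y_0\sim\mu_\omega$, which from $(n,i)$ moves to $(n+1,j)$ with probability $P_n(i,j)$, to $(n,j)$ with probability $R_n(i,j)$, and to $(n-1,j)$ with probability $Q_n(i,j)$. The annealed law is $\mathbb{P}^\mu(F\times G)=\int_F P_\omega^\mu(G)\,P(d\omega)$, with expectation $\mathbb{E}^\mu$. The layer $n$ is $L_n=\{(n,j):1\le j\le d\}$, and $T_1=\inf\{t\ge0: X_t\in L_1\}$. Condition C. (C1) $(\Omega,\mathscr{F},P,\theta)$ is ergodic. (C2) $E\log(1-\|R_n+P_n\|)^{-1}<\infty$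 and $E\log(1-\|R_n+Q_n\|)^{-1}<\infty$. (C3) For all $j\in\mathscr{D}$ and all $n$, $\sum_{i=1}^dQ_n(i,j)>0$ and $\sum_{i=1}^dP_n(i,j)>0$, $P$-a.s. (C4) With positive $P$-probability, the layer $0$ is in one communication class of the chain. Matrices. Under Condition C, $(\zeta_n)_{n\in\mathbb{Z}}$ denotes the ($P$-a.s. unique) sequence of stochastic $d\times d$ matrices satisfying $\zeta_n=(I-Q_n\zeta_{n-1}-R_n)^{-1}P_n$ for all $n\in\mathbb{Z}$, and $$A_n:=(I-Q_n\zeta_{n-1}-R_n)^{-1}Q_n,\qquad \widetilde{u}_n:=(I-Q_n\zeta_{n-1}-R_n)^{-1}.$$ Standing assumption: $\lambda^+:=\lim_{n\to\infty}\frac1n\log\|A_nA_{n-1}\cdots A_1\|<0$; under Condition C this is known to be equivalent to transience to the right. Vectors $\mathbf{y}_n$. $\mathbf{y}_n:=\lim_{a\to-\infty}\mathbf{u}_a\zeta_a\zeta_{a+1}\cdots\zeta_n$, where $(\mathbf{u}_a)$ is any sequence of probability row vectors on $\mathscr{D}$; under Condition C the limit is known to exist $P$-a.s., does not depend on $(\mathbf{u}_a)$, and $(\mathbf{y}_n)$ is the unique sequence of probability vectors with $\mathbf{y}_n=\mathbf{y}_{n-1}\zeta_n$ for all $n$; it is stationary with strictly positive entries. Measures. Put $v_p=1/\mathbb{E}^\mu T_1$ (so $v_p>0$ means $\mathbb{E}^\mu T_1<\infty$), with $\mu_\omega=\mathbf{y}_{-1}$. Let $\overline{\omega}_n=\theta^{\xi_n}\omega$,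 $n\ge0$ (environment viewed from the particle). For $B\in\mathscr{F}$, $i\in\mathscr{D}$ define $$Q(B,i):=v_p\,\mathbb{E}^\mu\Big(\sum_{n=0}^{T_1-1}\mathbf{I}_{B}(\overline{\omega}_n)\,\mathbf{I}_{\{Y_n=i\}}\Big),$$ where $\mathbf{I}$ denotes an indicator; this defines a probability measure on $\Omega\times\mathscr{D}$ that is invariant for the Markov chain $(\overline{\omega}_n,Y_n)$. Set $Q_i(B):=Q(B,i)$ and $\overline{Q}(B):=Q(B,\mathscr{D})=\sum_{i\in\mathscr{D}}Q(B,i)$. *)

(* Defs.v *)
From HB Require Import structures.
From mathcomp Require Import all_boot all_order all_algebra.
From mathcomp Require Import all_classical all_reals all_analysis.

Set Implicit Arguments.
Unset Strict Implicit.
Unset Printing Implicit Defensive.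
Import Order.TTheory GRing.Theory Num.Theory.
Import numFieldNormedType.Exports.

Local Open Scope classical_set_scope.
Local Open Scope ring_scope.

(* Layers have d.+1 states, indexed by 'I_d.+1: the parameter d is one less than
   the size of the matrices, so every size >= 1 is covered. *)

Section Matrices.
Context {R : realType} {d : nat}.
Implicit Types A : 'M[R]_d.+1.

Definition nonneg_mx A : bool := [forall i, forall j, 0 <= A i j].

Definition stochastic_mx A : bool :=
  nonneg_mx A && [forall i, \sum_j A i j == 1].

Definition prob_row (u : 'rV[R]_d.+1) : Prop :=
  (forall i, 0 <= u 0 i) /\ \sum_i u 0 i = 1.

(* max_i sum_j |a(i,j)|; not the library's norm on matrices, which is the
   entrywise maximum *)
Definition mx_rownorm A : R := \big[Num.max/0]_i \sum_j `|A i j|.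

End Matrices.

Section Environment.
Variables (R : realType) (d : nat).

Definition layer_ok (t : 'M[R]_d.+1 * 'M[R]_d.+1 * 'M[R]_d.+1) : bool :=
  [&& nonneg_mx t.1.1, nonneg_mx t.1.2, nonneg_mx t.2 &
      stochastic_mx (t.1.1 + t.1.2 + t.2)].

Definition layer := {t : 'M[R]_d.+1 * 'M[R]_d.+1 * 'M[R]_d.+1 | layer_ok t}.

HB.instance Definition _ := Choice.on layer.

Lemma layer_ok_id : layer_ok (0, 0, 1%:M).
Proof.
have n0 : nonneg_mx (0 : 'M[R]_d.+1).
  by apply/forallP => i; apply/forallP => j; rewrite mxE.
have n1 : nonneg_mx (1%:M : 'M[R]_d.+1).
  by apply/forallP => i; apply/forallP => j; rewrite mxE ler0n.
rewrite /layer_ok /= n0 n1 !add0r /= /stochastic_mx n1 /=.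
apply/forallP => i; rewrite (bigD1 i) //= mxE eqxx big1 ?addr0 // => j ji.
by rewrite mxE eq_sym (negbTE ji).
Qed.

HB.instance Definition _ := isPointed.Build layer
  (exist (fun t => is_true (layer_ok t)) (0, 0, 1%:M) layer_ok_id).

Definition env := int -> layer.

Definition Pm (w : env) (n : int) : 'M[R]_d.+1 := (val (w n)).1.1.
Definition Qm (w : env) (n : int) : 'M[R]_d.+1 := (val (w n)).1.2.
Definition Rm (w : env) (n : int) : 'M[R]_d.+1 := (val (w n)).2.

Definition env_cylinders : set (set env) :=
  [set A | exists (n : int) (i j : 'I_d.+1) (B : set R), measurable B /\
    [\/ A = [set w | B (Pm w n i j)],
        A = [set w | B (Qm w n i j)] |
        A = [set w | B (Rm w n i j)]]].

Definition Omega := g_sigma_algebraType env_cylinders.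

(* shift k w = theta^k w *)
Definition shift (k : int) (w : Omega) : Omega := fun n => w (n + k).

Definition stationary (P : set Omega -> \bar R) :=
  forall B : set Omega, measurable B -> P (shift 1 @^-1` B) = P B.

Definition ergodic (P : set Omega -> \bar R) :=
  forall B : set Omega, measurable B -> shift 1 @^-1` B = B ->
    P B = 0%E \/ P B = 1%E.

End Environment.

HB.instance Definition _ := isPointed.Build int 0.
HB.instance Definition _ (d : nat) := isPointed.Build 'I_d.+1 ord0.

Section Walk.
Variables (R : realType) (d : nat).

Definition path_cylinders : set (set (nat -> int * 'I_d.+1)) :=
  [set A | exists (n : nat) (s : int * 'I_d.+1), A = [set x | x n = s]].

Definition Traj := g_sigma_algebraType path_cylinders.

Definition xi (x : Traj) (n : nat) : int := (x n).1.
Definition Y (x : Traj) (n : nat) : 'I_d.+1 := (x n).2.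

Definition step (w : Omega R d) (s t : int * 'I_d.+1) : R :=
  if t.1 == s.1 + 1 then Pm w s.1 s.2 t.2
  else if t.1 == s.1 then Rm w s.1 s.2 t.2
  else if t.1 == s.1 - 1 then Qm w s.1 s.2 t.2
  else 0.

Definition init (m : 'rV[R]_d.+1) (s : int * 'I_d.+1) : R :=
  if s.1 == 0 then m 0 s.2 else 0.

(* The finite-dimensional distributions determine the law, since the cylinders
   below form a pi-system generating the sigma-algebra of Traj. *)
Definition quenched_law (w : Omega R d) (m : 'rV[R]_d.+1)
    (L : set Traj -> \bar R) :=
  forall (n : nat) (s : nat -> int * 'I_d.+1),
    L [set x : Traj | forall k, (k <= n)%N -> x k = s k] =
      (init m (s 0%N) * \prod_(k < n) step w (s k) (s k.+1))%:E.

Definition annealed_law (P : {measure set (Omega R d) -> \bar R})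
    (L : Omega R d -> {measure set Traj -> \bar R})
    (PP : set (Omega R d * Traj) -> \bar R) :=
  forall (F : set (Omega R d)) (G : set Traj), measurable F -> measurable G ->
    PP (F `*` G) = (\int[P]_(w in F) L w G)%E.

(* inf of the empty set is +oo *)
Definition T1 (x : Traj) : \bar R :=
  ereal_inf [set (t%:R)%:E | t in [set t : nat | xi x t = 1]].

Definition transient_right (PP : {measure set (Omega R d * Traj) -> \bar R}) :=
  {ae PP, forall wx, ((xi wx.2 n)%:~R : R) @[n --> \oo] --> +oo}.

Definition leads_to (w : Omega R d) (s t : int * 'I_d.+1) : Prop :=
  exists p : seq (int * 'I_d.+1),
    path (fun a b => 0 < step w a b) s p /\ last s p = t.

Definition layer0_one_class (w : Omega R d) : Prop :=
  forall i j : 'I_d.+1, leads_to w (0, i) (0, j).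

End Walk.

Arguments xi {d}.
Arguments Y {d}.

Section ConditionC.
Variables (R : realType) (d : nat).

(* In \bar R, 0^-1 = +oo and lne +oo = +oo, so the expectation in (C2) is
   infinite when the norm equals 1 with positive probability. *)
Definition log_inv_gap (A : 'M[R]_d.+1) : \bar R :=
  lne ((1 - mx_rownorm A)%:E^-1)%E.

Record conditionC (P : probability (Omega R d) R) : Prop := {
  C1 : ergodic P ;
  C2 : forall n : int,
    (\int[P]_w log_inv_gap (Rm w n + Pm w n)%R < +oo)%E /\
    (\int[P]_w log_inv_gap (Rm w n + Qm w n)%R < +oo)%E ;
  C3 : forall (j : 'I_d.+1) (n : int),
    {ae P, forall w, 0 < \sum_i Qm w n i j /\ 0 < \sum_i Pm w n i j} ;
  C4 : (0 < P [set w | layer0_one_class w])%E }.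

End ConditionC.

Section Matrices2.
Variables (R : realType) (d : nat).
Implicit Types (w : Omega R d) (z : int -> 'M[R]_d.+1).

Definition resolvent_arg w z (n : int) : 'M[R]_d.+1 :=
  1%:M - Qm w n *m z (n - 1) - Rm w n.

Definition utilde w z n : 'M[R]_d.+1 := invmx (resolvent_arg w z n).

Definition Amx w z n : 'M[R]_d.+1 := utilde w z n *m Qm w n.

(* invmx A = A when A is singular, hence the explicit invertibility *)
Definition is_zeta w z : Prop := forall n : int,
  [/\ stochastic_mx (z n), resolvent_arg w z n \in unitmx &
      z n = utilde w z n *m Pm w n].

(* y n is the limit of u_a z_a z_(a+1) ... z_n with a = n - m, m -> +oo *)
Definition is_y z (y : int -> 'rV[R]_d.+1) : Prop :=
  forall (n : int) (u : int -> 'rV[R]_d.+1), (forall a, prob_row (u a)) ->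
    (u (n - m%:Z) *m \prod_(l < m.+1) z (n - m%:Z + l%:Z)) @[m --> \oo]
      --> y n.

(* z_0 ... z_(k-1) A_k ... A_1 u~_0 *)
Definition series_term w z (k : nat) : 'M[R]_d.+1 :=
  (\prod_(l < k) z l%:Z) *m (\prod_(l < k) Amx w z (k%:Z - l%:Z))
    *m utilde w z 0.

Local Open Scope ereal_scope.

(* The series has non-negative terms and is summed entrywise in [0, +oo]. *)
Definition series_mx w z (j i : 'I_d.+1) : \bar R :=
  \sum_(0 <= k <oo) (series_term w z k j i)%:E.

Definition mu_series (m : 'rV[R]_d.+1) w z (i : 'I_d.+1) : \bar R :=
  \sum_(j < d.+1) (m 0%R j)%:E * series_mx w z j i.

Definition Lambda_i (v : \bar R) (m : 'rV[R]_d.+1) w z (i : 'I_d.+1) :=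
  v * mu_series m w z i.

Definition Lambda (v : \bar R) (m : 'rV[R]_d.+1) w z : \bar R :=
  v * \sum_(i < d.+1) mu_series m w z i.

End Matrices2.

Section InvariantMeasure.
Variables (R : realType) (d : nat).
Variable PP : {measure set (Omega R d * Traj d) -> \bar R}.
Local Open Scope ereal_scope.

(* +oo^-1 = 0 in \bar R *)
Definition vp : \bar R := (\int[PP]_wx T1 R wx.2)^-1.

Definition Qi (i : 'I_d.+1) (B : set (Omega R d)) : \bar R :=
  vp * \int[PP]_wx
    \sum_(0 <= n <oo | (n%:R)%:E < T1 R wx.2)
      (\1_B (shift (xi wx.2 n) wx.1) * (Y wx.2 n == i)%:R)%:E.

Definition Qbar (B : set (Omega R d)) : \bar R := \sum_(i < d.+1) Qi i B.

End InvariantMeasure.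

Definition has_density (disp : measure_display) (T : measurableType disp)
    (R : realType) (P : {measure set T -> \bar R}) (nu : set T -> \bar R)
    (g : T -> \bar R) : Prop :=
  [/\ P.-integrable [set: T] g,
      {ae P, forall w, (0 <= g w)%E} &
      forall B : set T, measurable B -> nu B = (\int[P]_(w in B) g w)%E].

(* Main.v *)
Require Import Defs.
From HB Require Import structures.
From mathcomp Require Import all_boot all_order all_algebra.
From mathcomp Require Import all_classical all_reals all_analysis.
From mathcomp Require Import measurable_realfun zify lra.
Import Order.TTheory GRing.Theory Num.Theory.
Import numFieldNormedType.Exports.
Local Open Scope classical_set_scope.
Local Open Scope ring_scope.

(** Q_i(B) counts, up to the factor v_p, the visits of the walk before T_1 to
    points (-k,i) with B seen from layer -k.  Summing over k and moving the
    environment by theta^k, which preserves P, turns the count into an integral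
    over B of the sum over k of the Green function G_k(theta^k w, i), where
    G_k(w, i) is the expected number of visits to (-k,i) before T_1 for the walk
    in w ([integral_seen_at]).  The series of the theorem is this sum, written
    with the matrices zeta and the vectors y; two facts are behind that.

    - [occupation_series].  In an environment where T_1 is almost surely finite,
      G_k = mu A_0 A_(-1) ... A_(-k+1) u~_(-k) for every stochastic solution zeta
      of the hitting equation, whether or not it is unique.  The right-hand side
      solves the forward equation of the killed walk and G_k is its least
      non-negative solution; the difference carries no flux through the edge from
      layer 0 to layer 1, because both sides send total mass 1 through it.  As no
      row of P vanishes ([ae_rows_gt0], from (C2)), the difference is zero on
      layer 0, then on layer -1, and so on.  Hence zeta may be taken from w and
      the walk from theta^k w, which produces the factors A_k ... A_1 u~_0.

    - [ae_mu_theta].  The initial law at theta^k w is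
      y_(k-1)(w) = mu_w zeta_0 ... zeta_(k-1).  This does need
      zeta(theta w) = zeta(w) shifted, that is uniqueness of zeta.  Two solutions
      differ by at most the probability of staying forever below a layer
      ([hitting_unique]), so it is enough that the walk started anywhere reaches
      every layer to its right ([ae_hits_right]).  Transience is assumed only from
      the initial law; on the event of (C4) it spreads to all of layer 0, by (C3)
      it passes from layer 0 to layer 1, and ergodicity makes an event of positive
      probability with this inheritance almost sure.

    The expectation of T_1 lies in [1, +oo), so that v_p is a positive real and
    the densities are integrable. *)

Local Notation theta := Defs.shift.

(** * Non-negative matrices *)

Section EntrywiseOrder.
Context {R : realType}.

Definition lemx {m n} (A B : 'M[R]_(m, n)) := forall i j, A i j <= B i j.

Lemma lemx_refl m n (A : 'M[R]_(m, n)) : lemx A A.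
Proof. by move=> i j. Qed.

Lemma lemxD m n (A B C D : 'M[R]_(m, n)) :
  lemx A B -> lemx C D -> lemx (A + C) (B + D).
Proof. by move=> AB CD i j; rewrite !mxE lerD. Qed.

Lemma lemxMl m n p (A : 'M[R]_(m, n)) (B C : 'M[R]_(n, p)) :
  lemx 0 A -> lemx B C -> lemx (A *m B) (A *m C).
Proof.
move=> A0 BC i j; rewrite !mxE ler_sum // => k _.
by apply: ler_wpM2l => //; have := A0 i k; rewrite mxE.
Qed.

Lemma mx_ge0D m n (A B : 'M[R]_(m, n)) : lemx 0 A -> lemx 0 B -> lemx 0 (A + B).
Proof. by move=> A0 B0; rewrite -[X in lemx X _]addr0; exact: lemxD. Qed.

Lemma mx_ge0M m n p (A : 'M[R]_(m, n)) (B : 'M[R]_(n, p)) :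
  lemx 0 A -> lemx 0 B -> lemx 0 (A *m B).
Proof. by move=> A0 B0; rewrite -(mulmx0 p A); exact: lemxMl. Qed.

Lemma col_mulmx m n p j (A : 'M[R]_(m, n)) (B : 'M[R]_(n, p)) :
  col j (A *m B) = A *m col j B.
Proof. by rewrite !colE mulmxA. Qed.

Lemma nonneg_mxP d (A : 'M[R]_d.+1) : reflect (lemx 0 A) (nonneg_mx A).
Proof.
apply: (iffP forallP) => [h i j|h i].
  by rewrite mxE; exact: (forallP (h i) j).
by apply/forallP => j; have := h i j; rewrite mxE.
Qed.

Lemma mulmx_ones d (A : 'M[R]_d.+1) i :
  (A *m const_mx 1 : 'cV_d.+1) i 0 = \sum_j A i j.
Proof. by rewrite mxE; apply: eq_bigr => j _; rewrite mxE mulr1. Qed.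

Lemma stochastic_mxP d (A : 'M[R]_d.+1) :
  reflect (lemx 0 A /\ A *m const_mx 1 = const_mx 1 :> 'cV_d.+1) (stochastic_mx A).
Proof.
apply: (iffP andP) => -[h1 h2]; split; try exact/nonneg_mxP.
  apply/matrixP => i j; rewrite ord1 mulmx_ones mxE.
  exact/eqP/(forallP h2).
by apply/forallP => i; rewrite -mulmx_ones h2 mxE.
Qed.

Lemma cvgr_sum (I : finType) (f : I -> nat -> R) (l : I -> R) :
  (forall i, f i @ \oo --> l i) ->
  (fun n => \sum_i f i n) @ \oo --> \sum_i l i.
Proof.
by move=> fl; apply: cvg_big => // x; exact: add_continuous.
Qed.

(** A non-negative matrix with all row sums below 1 satisfies the maximum
    principle: look at the row where the vector is smallest. *)
Lemma resolvent_ge0 d r (M : 'M[R]_d.+1) (X B : 'M[R]_(d.+1, r)) :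
  lemx 0 M -> (forall i, \sum_j M i j < 1) -> lemx 0 B -> X = M *m X + B ->
  lemx 0 X.
Proof.
move=> M0 M1 B0 XE i j.
pose k := [arg min_(l < i) X l j]%O.
have kmin l : X k j <= X l j.
  by rewrite /k; case: arg_minP => // a _; apply.
suff Xk : 0 <= X k j by rewrite mxE; exact: le_trans (kmin i).
rewrite leNgt; apply/negP => Xk.
have := M1 k; rewrite ltNge => /negP; apply.
rewrite -(ler_nM2r Xk) mul1r mulr_suml {2}XE !mxE.
have := B0 k j; rewrite mxE => Bk.
apply: ler_wpDr => //; apply: ler_sum => l _.
by apply: ler_wpM2l => //; have := M0 k l; rewrite mxE.
Qed.

End EntrywiseOrder.

(** * The walk killed on leaving a half line *)

Section HalfLine.
Context {R : realType} {d : nat}.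
Variables U S D : nat -> 'M[R]_d.+1.

(** Layers are numbered by their depth: from depth q the walk moves by U q to
    depth q-1, by S q within its depth and by D q to depth q+1, and it is lost
    when it moves up from depth 0.  Acting on sequences of matrices with any
    number r of columns covers vectors and Green matrices at once. *)
Definition kill {r} (f : nat -> 'M[R]_(d.+1, r)) (q : nat) : 'M[R]_(d.+1, r) :=
  (if q is p.+1 then U q *m f p else 0) + S q *m f q + D q *m f q.+1.

Definition survival (m : nat) : nat -> 'cV[R]_d.+1 :=
  iter m kill (fun=> const_mx 1).

Definition layer_id (k q : nat) : 'M[R]_d.+1 := if q == k then 1%:M else 0.

Definition occupation (n k : nat) : 'M[R]_d.+1 := iter n kill (layer_id k) 0%N.

Lemma killMr r s (f : nat -> 'M[R]_(d.+1, r)) (B : 'M[R]_(r, s)) :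
  kill (fun q => f q *m B) = (fun q => kill f q *m B).
Proof.
apply/funext => -[|q]; rewrite /kill !mulmxDl ?mul0mx -?mulmxA //.
Qed.

Lemma killD r (f g : nat -> 'M[R]_(d.+1, r)) :
  kill (fun q => f q + g q) = (fun q => kill f q + kill g q).
Proof.
apply/funext => -[|q]; rewrite /kill !mulmxDr [RHS]addrACA; congr (_ + _).
  by rewrite !add0r.
by rewrite [RHS]addrACA.
Qed.

Lemma iter_killMr n r s (f : nat -> 'M[R]_(d.+1, r)) (B : 'M[R]_(r, s)) :
  iter n kill (fun q => f q *m B) = (fun q => iter n kill f q *m B).
Proof. by elim: n => //= n ->; rewrite killMr. Qed.

Lemma iter_killD n r (f g : nat -> 'M[R]_(d.+1, r)) :
  iter n kill (fun q => f q + g q) = (fun q => iter n kill f q + iter n kill g q).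
Proof. by elim: n => //= n ->; rewrite killD. Qed.

Lemma iter_kill0 n r : iter n kill (fun=> 0 : 'M[R]_(d.+1, r)) = fun=> 0.
Proof.
elim: n => //= n ->; apply/funext => -[|q]; rewrite /kill !mulmx0 !addr0 //.
Qed.

Lemma kill_layer_id k : kill (layer_id k) =
  fun q => (if k is l.+1 then layer_id l q *m D l else 0)
           + layer_id k q *m S k + layer_id k.+1 q *m U k.+1.
Proof.
apply/funext => q; rewrite /kill /layer_id [RHS]addrC [X in _ = _ + X]addrC addrA.
congr (_ + _ + _).
- by case: q => [|q]; rewrite ?mul0mx// eqSS; case: eqP => [->|];
    rewrite ?mulmx1 ?mul1mx ?mulmx0 ?mul0mx.
- by case: eqP => [->|]; rewrite ?mulmx1 ?mul1mx ?mulmx0 ?mul0mx.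
- by case: k => [|k]; rewrite ?mulmx0// eqSS; case: eqP => [->|];
    rewrite ?mulmx1 ?mul1mx ?mulmx0 ?mul0mx.
Qed.

(** Forward equation: the last step is split off, whereas [kill] splits off the
    first one. *)
Lemma occupationS n k : occupation n.+1 k =
  (if k is l.+1 then occupation n l *m D l else 0)
  + occupation n k *m S k + occupation n k.+1 *m U k.+1.
Proof.
rewrite /occupation iterSr kill_layer_id !iter_killD !iter_killMr.
by case: k => [|k]; rewrite ?iter_kill0 ?iter_killMr.
Qed.

Lemma occupation0 k : occupation 0 k = if k == 0%N then 1%:M else 0.
Proof. by rewrite /occupation /= /layer_id eq_sym. Qed.

Hypothesis U0 : forall q, lemx 0 (U q).
Hypothesis S0 : forall q, lemx 0 (S q).
Hypothesis D0 : forall q, lemx 0 (D q).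
Hypothesis USD1 : forall q,
  (U q + S q + D q) *m const_mx 1 = const_mx 1 :> 'cV[R]_d.+1.

Lemma iter_kill_ge0 n r (f : nat -> 'M[R]_(d.+1, r)) :
  (forall q, lemx 0 (f q)) -> forall q, lemx 0 (iter n kill f q).
Proof.
move=> f0; elim: n => //= n IH q.
apply: mx_ge0D; last exact: mx_ge0M.
apply: mx_ge0D; last exact: mx_ge0M.
by case: q => [|q]; [exact: lemx_refl|apply: mx_ge0M].
Qed.

Lemma layer_id_ge0 k q : lemx 0 (layer_id k q).
Proof. by move=> i j; rewrite /layer_id; case: eqP => _; rewrite !mxE ?ler0n. Qed.

Lemma occupation_ge0 n k : lemx 0 (occupation n k).
Proof. by apply: iter_kill_ge0 => q; exact: layer_id_ge0. Qed.

Lemma survival_ge0 n q : lemx 0 (survival n q).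
Proof. by apply: iter_kill_ge0 => {}q i j; rewrite !mxE ler01. Qed.

(** Mass can only leave through the upper end of the half line. *)
Lemma survivalS n q :
  survival n q = survival n.+1 q + iter n kill (layer_id 0) q *m (U 0%N *m const_mx 1).
Proof.
rewrite /survival iterSr.
rewrite -[X in _ = _ + X](congr1 (fun f => f q) (iter_killMr n _ _ _ _)).
rewrite -[RHS](congr1 (fun f => f q) (iter_killD n _ _ _)).
congr (iter n kill _ q); apply/funext => -[|p].
  by rewrite /kill /layer_id eqxx mul1mx add0r addrC addrA -!mulmxDl USD1.
by rewrite /kill /layer_id /= mul0mx addr0 -!mulmxDl USD1.
Qed.

(** Summation by parts of [survivalS]: the flux through the top of the half line
    up to time n is the mass lost up to time n. *)
Lemma sum_exit_flux n :
  \sum_(l < n) occupation l 0 *m (U 0%N *m const_mx 1) =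
  (const_mx 1 : 'cV[R]_d.+1) - survival n 0%N.
Proof.
elim: n => [|n IH]; first by rewrite big_ord0 subrr.
rewrite big_ord_recr /= IH [X in _ - X + _]survivalS /occupation.
by rewrite opprD -!addrA; congr (_ + _); rewrite addNr addr0.
Qed.

Section Green.
Variable z : nat -> 'M[R]_d.+1.

(** The matrices I - Q zeta - R, u~ and A in depth coordinates: the layer to the
    left of depth q is depth q+1. *)
Definition green_inv (q : nat) : 'M[R]_d.+1 := 1%:M - D q *m z q.+1 - S q.
Definition green_local q : 'M[R]_d.+1 := invmx (green_inv q).
Definition green_step q : 'M[R]_d.+1 := green_local q *m D q.

Hypothesis z_stoch : forall q, stochastic_mx (z q).
Hypothesis z_unit : forall q, green_inv q \in unitmx.
Hypothesis zE : forall q, z q = green_local q *m U q.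
Hypothesis U_gt0 : forall q i, 0 < \sum_j U q i j.

Let z0 q : lemx 0 (z q). Proof. by case/stochastic_mxP: (z_stoch q). Qed.
Let z1 q : z q *m const_mx 1 = const_mx 1 :> 'cV[R]_d.+1.
Proof. by case/stochastic_mxP: (z_stoch q). Qed.

Lemma green_local_ge0 q : lemx 0 (green_local q).
Proof.
apply: (resolvent_ge0 _ _ (D q *m z q.+1 + S q) _ 1%:M).
- by apply: mx_ge0D => //; exact: mx_ge0M.
- move=> i; rewrite -mulmx_ones mulmxDl -mulmxA z1 -mulmxDl addrC.
  have /matrixP/(_ i 0) := USD1 q; rewrite -addrA mulmxDl mxE mulmx_ones [RHS]mxE.
  by move=> E; rewrite -[ltRHS]E ltrDr mulmx_ones.
- by move=> i j; rewrite !mxE ler0n.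
- apply/eqP; rewrite addrC -subr_eq -{1}[green_local q]mul1mx -mulmxBl opprD addrA.
  exact/eqP/(mulmxV (z_unit q)).
Qed.

Lemma green_step_ge0 q : lemx 0 (green_step q).
Proof. by apply: mx_ge0M => //; exact: green_local_ge0. Qed.

Variable mu : 'rV[R]_d.+1.
Hypothesis mu0 : lemx 0 mu.
Hypothesis mu1 : mu *m const_mx 1 = const_mx 1 :> 'M[R]_1.
Hypothesis exits : (fun n => (mu *m survival n 0%N) 0 0) @ \oo --> (0 : R).

Definition green k : 'rV[R]_d.+1 :=
  mu *m (\prod_(l < k) green_step l) *m green_local k.

(** [green] solves the equation of which the occupation numbers are the least
    non-negative solution. *)
Lemma greenE k : green k =
  (if k is l.+1 then green l *m D l else mu) + green k *m S k
  + green k.+1 *m U k.+1.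
Proof.
have E : green k *m green_inv k = if k is l.+1 then green l *m D l else mu.
  rewrite /green -mulmxA mulVmx // mulmx1; case: k => [|k].
    by rewrite big_ord0 mulmx1.
  by rewrite big_ord_recr /= -!mulmxA.
rewrite -E /green_inv !mulmxBr mulmx1.
have -> : green k.+1 *m U k.+1 = green k *m (D k *m z k.+1).
  by rewrite zE /green big_ord_recr /= !mulmxA.
by rewrite !subrK.
Qed.

Lemma green_ge0 k : lemx 0 (green k).
Proof.
apply: mx_ge0M; last exact: green_local_ge0.
apply: mx_ge0M => //; elim/big_ind: _ => [|A B|l _].
- by move=> i j; rewrite !mxE ler0n.
- exact: mx_ge0M.
- exact: green_step_ge0.
Qed.

(** The part of [green] not yet accounted for at time N. *)
Let rest N k : 'rV[R]_d.+1 := green k - \sum_(n < N) mu *m occupation n k.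

Let restS N k : rest N.+1 k = (if k is l.+1 then rest N l *m D l else 0)
  + rest N k *m S k + rest N k.+1 *m U k.+1.
Proof.
rewrite /rest big_ord_recl /= occupation0 [in LHS]greenE.
under eq_bigr do rewrite /bump /= add1n occupationS !mulmxDr !mulmxA.
rewrite !big_split /= -!mulmx_suml !mulmxBl.
case: k => [|k] /=.
  under eq_bigr do rewrite mulmx0.
  by rewrite big1_eq !add0r mulmx1 -[mu + _ + _]addrA opprD addrACA subrr add0r opprD addrACA.
under eq_bigr do rewrite mulmxA.
rewrite -mulmx_suml mulmx0 add0r opprD addrACA; congr (_ + _).
by rewrite opprD addrACA mulmxBl.
Qed.

Let rest_ge0 N k : lemx 0 (rest N k).
Proof.
elim: N k => [|N IH] k.
  by rewrite /rest big_ord0 subr0; exact: green_ge0.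
rewrite restS; apply: mx_ge0D; last exact: mx_ge0M.
apply: mx_ge0D; last exact: mx_ge0M.
by case: k => [|k]; [exact: lemx_refl|apply: mx_ge0M].
Qed.

(** Both [green] and the occupation numbers send mass through the top of the
    half line; [green] sends mu z_0, of total mass 1, so only the survival
    probability is missing. *)
Let rest_exit N : rest N 0 *m (U 0%N *m const_mx 1) = mu *m survival N 0%N.
Proof.
rewrite /rest mulmxBl mulmx_suml.
under eq_bigr do rewrite -mulmxA.
rewrite -mulmx_sumr sum_exit_flux mulmxBr mu1 mulmxA.
have -> : green 0 *m U 0%N = mu *m z 0%N.
  by rewrite /green big_ord0 mulmx1 -mulmxA -zE.
by rewrite -mulmxA z1 mu1 subKr.
Qed.

Lemma mulmx_rowsum_ge (v : 'rV[R]_d.+1) (A : 'M[R]_d.+1) i :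
  lemx 0 v -> lemx 0 A ->
  v 0 i * \sum_j A i j <= (v *m (A *m const_mx 1 : 'cV_d.+1)) 0 0.
Proof.
move=> v0 A0; rewrite [leRHS]mxE [leRHS](bigD1 i) //= mulmx_ones lerDl.
apply: sumr_ge0 => j _; rewrite mulmx_ones mulr_ge0 //.
  by have := v0 0 j; rewrite mxE.
by apply: sumr_ge0 => l _; have := A0 j l; rewrite mxE.
Qed.

(** By [rest_exit] the remainder dies out at depth 0.  The forward equation bounds
    the flow of the remainder from depth k+1 up to depth k by the remainder at
    depth k, and each state of depth k+1 has a positive chance to step up. *)
Let rest_cvg k i : (fun N => rest N k 0 i) @ \oo --> (0 : R).
Proof.
elim: k i => [|k IH] i.
  have c0 := U_gt0 0 i.
  apply: (@squeeze_cvgr _ _ _ _ (fun=> 0)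
    (fun N => (\sum_j U 0%N i j)^-1 * (mu *m survival N 0%N) 0 0)).
  - near=> N; apply/andP; split; first by have := rest_ge0 N 0%N 0 i; rewrite mxE.
    by rewrite ler_pdivlMl // mulrC -rest_exit mulmx_rowsum_ge.
  - exact: cvg_cst.
  - by rewrite -[X in _ --> X](mulr0 ((\sum_j U 0%N i j)^-1)); exact: cvgMr.
have c0 := U_gt0 k.+1 i.
apply: (@squeeze_cvgr _ _ _ _ (fun=> 0)
    (fun N => (\sum_j U k.+1 i j)^-1 * \sum_j rest N.+1 k 0 j)).
- near=> N; apply/andP; split; first by have := rest_ge0 N k.+1 0 i; rewrite mxE.
  rewrite ler_pdivlMl // mulrC.
  apply: le_trans (mulmx_rowsum_ge (rest N k.+1) (U k.+1) i _ _) _ => //.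
  have restU : lemx (rest N k.+1 *m U k.+1) (rest N.+1 k).
    rewrite restS -[X in lemx X _]add0r; apply: lemxD; last exact: lemx_refl.
    apply: mx_ge0D; last exact: mx_ge0M.
    by case: (k) => [|l]; [exact: lemx_refl|apply: mx_ge0M].
  rewrite mulmxA mxE; apply: ler_sum => j _; rewrite [const_mx _ _ _]mxE mulr1.
  exact: restU.
- exact: cvg_cst.
- rewrite -[X in _ --> X](mulr0 ((\sum_j U k.+1 i j)^-1)); apply: cvgMr.
  have E : 0 = \sum_(j < d.+1) (0 : R) by rewrite big1_eq.
  rewrite [X in _ --> X]E; apply: cvgr_sum => j; have := IH j.
  by rewrite -(cvg_shiftS (fun N => rest N k 0 j)).
Unshelve. all: by end_near.
Qed.

(** The Green function of the killed walk, whichever solution z is used in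
    [green]. *)
Lemma occupation_series k i :
  (fun N => \sum_(n < N) (mu *m occupation n k) 0 i) @ \oo --> green k 0 i.
Proof.
have -> : (fun N => \sum_(n < N) (mu *m occupation n k) 0 i) =
    (fun N => green k 0 i - rest N k 0 i).
  apply/funext => N; rewrite /rest [(green k - _) 0 i]mxE [(- _ : 'rV_d.+1) 0 i]mxE.
  by rewrite summxE opprD opprK addrA subrr add0r.
by rewrite -[X in _ --> X]subr0; apply: cvgB; [exact: cvg_cst|exact: rest_cvg].
Qed.

End Green.

(** The product x_q ... x_0: as a function of q it is harmonic for the walk on the
    half line, with boundary value the identity, when x solves the hitting
    equation. *)
Fixpoint hitting_from (x : nat -> 'M[R]_d.+1) (q : nat) : 'M[R]_d.+1 :=
  if q is p.+1 then x p.+1 *m hitting_from x p else x 0%N.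

(** Two harmonic functions with values in [0, 1] and the same boundary values
    differ, after m steps, by at most the probability of having survived. *)
Lemma hitting_unique (z z' : nat -> 'M[R]_d.+1) :
  (forall q, stochastic_mx (z q)) -> (forall q, stochastic_mx (z' q)) ->
  (forall q, z q = U q + S q *m z q + D q *m z q.+1 *m z q) ->
  (forall q, z' q = U q + S q *m z' q + D q *m z' q.+1 *m z' q) ->
  (forall i, (fun n => survival n 0%N i 0) @ \oo --> (0 : R)) ->
  z 0%N = z' 0%N.
Proof.
move=> zs zs' zE zE' surv0.
pose h := hitting_from.
have hE x : (forall q, x q = U q + S q *m x q + D q *m x q.+1 *m x q) ->
    forall q, h x q = (if q is p.+1 then U q *m h x p else U q) + S q *m h x q + D q *m h x q.+1.
  move=> xE [|q] /=; first by rewrite {1}xE mulmxA.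
  by rewrite {1}xE !mulmxDl !mulmxA.
have h0 x : (forall q, stochastic_mx (x q)) -> forall q, lemx 0 (h x q).
  move=> xs; have x0 q : lemx 0 (x q) by case/stochastic_mxP: (xs q).
  by elim => [|q IH] //=; exact: mx_ge0M.
have h1 x : (forall q, stochastic_mx (x q)) -> forall q i j, h x q i j <= 1.
  move=> xs q i j.
  have h11 : h x q *m const_mx 1 = const_mx 1 :> 'cV_d.+1.
    elim: q => [|q IH] /=; first by case/stochastic_mxP: (xs 0%N).
    by rewrite -mulmxA IH; case/stochastic_mxP: (xs q.+1).
  have /matrixP/(_ i 0) := h11; rewrite mulmx_ones [RHS]mxE => <-.
  rewrite (bigD1 j) //= lerDl sumr_ge0 // => l _.
  by have := h0 x xs q i l; rewrite mxE.
have le_surv (x x' : nat -> 'M[R]_d.+1) n q j :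
    (forall q, stochastic_mx (x q)) -> (forall q, stochastic_mx (x' q)) ->
    (forall q, x q = U q + S q *m x q + D q *m x q.+1 *m x q) ->
    (forall q, x' q = U q + S q *m x' q + D q *m x' q.+1 *m x' q) ->
    lemx (col j (h x q)) (col j (h x' q) + survival n q).
  move=> xs xs' xE xE'; elim: n q => [|n IH] q.
    move=> i l; rewrite !mxE (le_trans (h1 _ xs q i j)) // lerDr.
    by have := h0 x' xs' q i j; rewrite mxE.
  rewrite (hE _ xE) (hE _ xE' q) /= /kill !linearD /=.
  have colM (A B C : 'M[R]_d.+1) (V : 'cV[R]_d.+1) : lemx 0 A -> lemx (col j B) (col j C + V) ->
      lemx (col j (A *m B)) (col j (A *m C) + A *m V).
    by move=> A0 BC; rewrite !col_mulmx -mulmxDr; exact: lemxMl.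
  rewrite [X in lemx _ X]addrACA; apply: lemxD; last exact/colM/(IH q.+1).
  rewrite [X in lemx _ X]addrACA; apply: lemxD; last exact/colM.
  case: q => [|q]; first by rewrite addr0; exact: lemx_refl.
  exact/colM.
have le_h (x x' : nat -> 'M[R]_d.+1) i j :
    (forall q, stochastic_mx (x q)) -> (forall q, stochastic_mx (x' q)) ->
    (forall q, x q = U q + S q *m x q + D q *m x q.+1 *m x q) ->
    (forall q, x' q = U q + S q *m x' q + D q *m x' q.+1 *m x' q) ->
    x 0%N i j <= x' 0%N i j.
  move=> xs xs' xE xE'; rewrite -[leRHS]addr0.
  have H : (fun n => x' 0%N i j + survival n 0%N i 0) @ \oo --> x' 0%N i j + 0.
    by apply: cvgD; [exact: cvg_cst|exact: surv0].
  apply: (cvgr_to_ge H).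
  by near=> n; have := le_surv x x' n 0%N j xs xs' xE xE' i 0; rewrite !mxE.
apply/matrixP => i j; apply/eqP; rewrite eq_le !le_h //.
Unshelve. all: by end_near.
Qed.
End HalfLine.

(** * Finite-dimensional laws and the Markov property *)

Lemma measure_setI_finType d (T : measurableType d) (R : realType)
    (m : {measure set T -> \bar R}) (I : finType) (A : set T) (B : I -> set T) :
  measurable A -> (forall i, measurable (B i)) -> trivIset setT B ->
  m (A `&` \bigcup_i B i) = (\sum_i m (A `&` B i))%E.
Proof.
move=> mA mB tB.
have mU (r : seq I) : measurable (\bigcup_(i in [set` r]) B i).
  by apply: fin_bigcup_measurable => //; exact: finite_seq.
suff H (r : seq I) : uniq r ->
    m (A `&` \bigcup_(i in [set` r]) B i) = (\sum_(i <- r) m (A `&` B i))%E.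
  rewrite -(H (index_enum I) (index_enum_uniq _)); congr (m (_ `&` _)).
  apply: eq_bigcupl; split=> i //= _; exact: mem_index_enum.
elim: r => [_|i r IH /= /andP[ir ur]].
  by rewrite big_nil set_nil bigcup_set0 setI0 measure0.
rewrite big_cons -IH// -measureU; first last.
- rewrite setIACA setIid -subset0 => x [_ [Bix [j /= jr Bjx]]].
  have ij : i = j by apply: (tB i j) => //; exists x.
  by move: ir; rewrite ij jr.
- exact: measurableI.
- exact: measurableI.
rewrite -setIUr; congr (m (_ `&` _)); apply/seteqP; split=> x /=.
  move=> [j]; rewrite /= inE => /orP[/eqP->|jr] Bj; [by left|by right; exists j].
move=> [Bi|[j jr Bj]]; first by exists i => //=; rewrite inE eqxx.
by exists j => //=; rewrite inE (jr : is_true _) orbT.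
Qed.

Section Trajectories.
Variable d : nat.

Lemma measurable_at (n : nat) (E : set (int * 'I_d.+1)) :
  measurable [set x : Traj d | E (x n)].
Proof.
have -> : [set x : Traj d | E (x n)] =
    \bigcup_(s in E) [set x : Traj d | x n = s].
  by apply/seteqP; split=> x /= => [Ex|[s Es ->]//]; exists (x n).
rewrite bigcup_mkcond; apply: countable_bigcupT_measurable => [|s]; first exact: countableP.
case: ifP => _ //; apply: sub_sigma_algebra.
by exists n, s.
Qed.

End Trajectories.

Section OneStep.
Context {R : realType} {d : nat}.
Implicit Types (w : Omega R d) (s : int * 'I_d.+1) (f : int * 'I_d.+1 -> R).

(** The steps -1, 0, 1 are encoded by 0, 1, 2 in 'I_3, so that one-step sums
    range over a finite type. *)
Definition nbr s (t : 'I_3 * 'I_d.+1) : int * 'I_d.+1 :=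
  (s.1 + (t.1 : nat)%:Z - 1, t.2).

Lemma nbr_inj s : injective (nbr s).
Proof.
by move=> [e j] [e' j'] [] E ->; congr (_, _); apply/val_inj => /=; lia.
Qed.

Definition killed_step w (alive : pred int) f s : R :=
  if alive s.1 then \sum_t step w s (nbr s t) * f (nbr s t) else 0.

Lemma sum_step w s f : \sum_t step w s (nbr s t) * f (nbr s t) =
  \sum_j Pm w s.1 s.2 j * f (s.1 + 1, j) + \sum_j Rm w s.1 s.2 j * f (s.1, j)
  + \sum_j Qm w s.1 s.2 j * f (s.1 - 1, j).
Proof.
rewrite -(pair_bigA _ (fun e j => step w s (nbr s (e, j)) * f (nbr s (e, j)))) /=.
rewrite [LHS]big_ord_recl [X in _ + X = _]big_ord_recl [X in _ + (_ + X) = _]big_ord_recl.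
rewrite big_ord0 addr0 /= [LHS]addrC [X in X + _ = _]addrC; congr (_ + _ + _).
- apply: eq_bigr => j _.
  have -> : nbr s (lift ord0 (lift ord0 ord0), j) = (s.1 + 1, j).
    by rewrite /nbr /= /bump /=; congr (_, _); lia.
  by rewrite /step /= eqxx.
- apply: eq_bigr => j _.
  have -> : nbr s (lift ord0 ord0, j) = (s.1, j).
    by rewrite /nbr /= /bump /=; congr (_, _); lia.
  rewrite /step /=; have -> : (s.1 == s.1 + 1) = false by lia.
  by rewrite eqxx.
- apply: eq_bigr => j _.
  have -> : nbr s (ord0, j) = (s.1 - 1, j).
    by rewrite /nbr /= /bump /=; congr (_, _); lia.
  rewrite /step /=; have -> : (s.1 - 1 == s.1 + 1) = false by lia.
  have -> : (s.1 - 1 == s.1) = false by lia.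
  by rewrite eqxx.
Qed.

Lemma layer_okP (t : layer R d) : let: (p, q, r) := val t in
  [/\ lemx 0 p, lemx 0 q, lemx 0 r &
     (p + r + q) *m const_mx 1 = const_mx 1 :> 'cV[R]_d.+1].
Proof.
case: t => [[[p q] r] /= /and4P[/= /nonneg_mxP p0 /nonneg_mxP q0 /nonneg_mxP r0]].
by move=> /stochastic_mxP[_]; rewrite addrAC; split.
Qed.

Lemma env_ok w n : [/\ lemx 0 (Pm w n), lemx 0 (Qm w n), lemx 0 (Rm w n) &
   (Pm w n + Rm w n + Qm w n) *m const_mx 1 = const_mx 1 :> 'cV[R]_d.+1].
Proof. by have := layer_okP (w n); rewrite /Pm /Qm /Rm; case: (val (w n)) => [[p q] r]. Qed.

Lemma step_ge0 w s t : 0 <= step w s t.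
Proof.
have [p q r _] := env_ok w s.1; rewrite /step.
have p' := p s.2 t.2; have q' := q s.2 t.2; have r' := r s.2 t.2.
by move: p' q' r'; rewrite !mxE; do 3 case: ifP => // _.
Qed.

Lemma sum_step1 w s : \sum_t step w s (nbr s t) = 1.
Proof.
under eq_bigr do rewrite -[step _ _ _]mulr1.
rewrite (sum_step w s (fun=> 1)).
have [_ _ _ /matrixP/(_ s.2 0)] := env_ok w s.1.
rewrite !mulmxDl [RHS]mxE => E; rewrite -[RHS]E [RHS]mxE [X in _ = X + _]mxE !mulmx_ones.
by congr (_ + _ + _); apply: eq_bigr => j _; rewrite mulr1.
Qed.

Lemma iter_killed_step_ge0 w alive f n s :
  (forall s, 0 <= f s) -> 0 <= iter n (killed_step w alive) f s.
Proof.
move=> f0; elim: n s => //= n IH s; rewrite /killed_step; case: ifP => // _.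
by apply: sumr_ge0 => t _; rewrite mulr_ge0 ?step_ge0.
Qed.

(** Below c a walk with unit steps cannot tell two killing rules apart which agree
    there and both kill at c. *)
Lemma killed_step_agree w (A B : pred int) f (c : int) :
  (forall p, p < c -> A p = B p) -> A c = false -> B c = false ->
  forall n s, s.1 <= c -> iter n (killed_step w A) f s = iter n (killed_step w B) f s.
Proof.
move=> AB Ac Bc; elim=> //= n IH s sc; rewrite /killed_step.
have [E|/eqP sNc] := eqVneq s.1 c; first by rewrite E Ac Bc.
rewrite AB; last by lia.
case: ifP => // _; apply: eq_bigr => t _; congr (_ * _); apply: IH.
by case: t => [[e ?] j] /=; lia.
Qed.

End OneStep.

Section Link.
Context {R : realType} {d : nat}.
Variables (w : Omega R d) (m : 'rV[R]_d.+1) (L : {measure set (Traj d) -> \bar R}).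
Hypothesis LP : quenched_law w m L.
Local Open Scope ereal_scope.
Hypothesis LT : L setT = 1.
Implicit Types (s : nat -> int * 'I_d.+1).

Definition cyl s n : set (Traj d) := [set x | forall k, (k <= n)%N -> x k = s k].

Lemma measurable_cyl s n : measurable (cyl s n).
Proof.
have -> : cyl s n = \bigcap_k [set x : Traj d | (fun t => (k <= n)%N -> t = s k) (x k)].
  by apply/seteqP; split=> x /= H k; [move=> _; exact: H|exact: H k I].
apply: bigcapT_measurable => k.
exact: (measurable_at _ k [set t | (k <= n)%N -> t = s k]).
Qed.

Lemma law_fin_num A : measurable A -> L A \is a fin_num.
Proof.
move=> mA; rewrite ge0_fin_numE //; apply: (@le_lt_trans _ _ (L setT)).
  by apply: le_measure; rewrite ?inE.
by rewrite LT ltry.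
Qed.

Definition extend s n (t : int * 'I_d.+1) : nat -> int * 'I_d.+1 :=
  fun k => if (k <= n)%N then s k else t.

Lemma cyl_extend s n t : cyl (extend s n t) n.+1 = cyl s n `&` [set x | x n.+1 = t].
Proof.
apply/seteqP; split=> x /=.
  move=> H; split; last by have := H n.+1 (leqnn _); rewrite /extend ltnn.
  by move=> k kn; rewrite H ?(leqW kn)// /extend kn.
move=> [H xn] k; rewrite leq_eqVlt => /orP[/eqP->|]; first by rewrite /extend ltnn.
by rewrite ltnS => kn; rewrite H// /extend kn.
Qed.

Lemma law_extend s n t :
  L (cyl s n `&` [set x | x n.+1 = t]) = L (cyl s n) * (step w (s n) t)%:E.
Proof.
rewrite -cyl_extend /cyl !LP -EFinM big_ord_recr /= mulrA /extend leqnn ltnn.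
congr ((_ * _ * _)%:E).
apply: eq_bigr => k _; rewrite (ltnW (ltn_ord k)).
by have := ltn_ord k => ->.
Qed.

(** The law of the next step has total mass 1 on the neighbours, so trajectories
    making another jump form a null set. *)
Lemma law_split s n (A : set (Traj d)) : measurable A ->
  L (cyl s n `&` A) =
  \sum_t L (cyl s n `&` [set x | x n.+1 = nbr (s n) t] `&` A).
Proof.
move=> mA.
pose B t := [set x : Traj d | x n.+1 = nbr (s n) t].
have mB t : measurable (B t).
  exact: (measurable_at _ n.+1 [set y | y = nbr (s n) t]).
have tB : trivIset setT B.
  by move=> t t' _ _ [x []]; rewrite /B /= => -> /nbr_inj.
have mC := measurable_cyl s n.
have mU : measurable (\bigcup_t B t).
  by apply: fin_bigcup_measurable => //; exact: finite_finset.
have null : L (cyl s n `\` \bigcup_t B t) = 0.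
  rewrite (_ : L (cyl s n `\` _) = L (cyl s n) - L (cyl s n `&` \bigcup_t B t)); last first.
    by apply: measureD => //; rewrite ltey_eq law_fin_num.
  rewrite measure_setI_finType //.
  under eq_bigr do rewrite law_extend.
  rewrite -ge0_sume_distrr; last by move=> t _; rewrite lee_fin step_ge0.
  by rewrite sumEFin sum_step1 mule1 subee // law_fin_num.
under eq_bigr do rewrite -setIA (setIC (B _)) setIA.
rewrite -(measure_setI_finType _ _ _ L _ (cyl s n `&` A) B) //; last exact: measurableI.
rewrite (_ : L (cyl s n `&` A) = L ((cyl s n `&` A) `\` \bigcup_t B t)
    + L ((cyl s n `&` A) `&` \bigcup_t B t)); last first.
  by apply: measureDI => //; exact: measurableI.
rewrite [X in X + _](_ : _ = 0) ?add0e //.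
apply: (subset_measure0 _ _ _ null) => //; first by apply: measurableD => //; exact: measurableI.
  exact: measurableD.
by move=> x [[? ?] ?].
Qed.

Definition alive_until (alive : pred int) (E : pred (int * 'I_d.+1)) n m : set (Traj d) :=
  [set x | (forall l, (n <= l <= n + m)%N -> alive (x l).1) /\ E (x (n + m)%N)].

Lemma measurable_alive_until alive E n k : measurable (alive_until alive E n k).
Proof.
have -> : alive_until alive E n k =
   (\bigcap_l [set x : Traj d | (fun t => (n <= l <= n + k)%N -> alive t.1) (x l)])
   `&` [set x | (fun t => E t) (x (n + k)%N)].
  apply/seteqP; split=> x /= [H e]; split=> // l; first by move=> _; exact: H.
  exact: (H l I).
apply: measurableI; last exact: (measurable_at _ (n + k) [set t | E t]).
apply: bigcapT_measurable => l.
exact: (measurable_at _ l [set t | (n <= l <= n + k)%N -> alive t.1]).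
Qed.

(** Markov property at time n, for the walk killed on leaving [alive]. *)
Lemma law_alive_until alive E k n s :
  L (cyl s n `&` alive_until alive E n k) = L (cyl s n) *
  (iter k (killed_step w alive) (fun t => (alive t.1 && E t)%:R) (s n))%:E.
Proof.
elim: k n s => [|k IH] n s /=.
  case: (boolP (alive (s n).1 && E (s n))) => [/andP[a e]|/negP ae].
    rewrite mule1; congr (L _); apply/seteqP; split=> x /=; first by case.
    move=> H; split => //; split; last by rewrite addn0 H.
    by move=> l; rewrite addn0 -eqn_leq => /eqP <-; rewrite H.
  rewrite mule0 -(measure0 L); congr (L _); apply/seteqP; split=> x //=.
  move=> [H [al ex]]; apply: ae; rewrite -(H n) //.
  by move: ex; rewrite addn0 => ->; rewrite al // addn0 leqnn.
rewrite /killed_step; case: ifPn => al; last first.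
  rewrite mule0 -(measure0 L); congr (L _); apply/seteqP; split=> x //=.
  by move=> [H [/(_ n)]]; rewrite leqnn leq_addr /= H // (negbTE al) => /(_ isT).
rewrite law_split; last exact: measurable_alive_until.
rewrite -sumEFin ge0_sume_distrr; last first.
  move=> t _; rewrite lee_fin mulr_ge0 ?step_ge0 //.
  by apply: iter_killed_step_ge0 => ?; rewrite ler0n.
apply: eq_bigr => t _.
rewrite EFinM muleA -law_extend -cyl_extend.
have := IH n.+1 (extend s n (nbr (s n) t)).
rewrite (_ : extend _ _ _ n.+1 = nbr (s n) t); last by rewrite /extend ltnn.
move=> <-; congr (L _); apply/seteqP; split=> x /= [H].
  move=> [alx ex]; split => //; split; last by rewrite addSnnS.
  by move=> l; rewrite addSnnS => /andP[/ltnW nl ln]; apply: alx; rewrite nl.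
move=> [alx ex]; split => //; split; last by rewrite -addSnnS.
move=> l /andP[]; rewrite leq_eqVlt => /orP[/eqP <- _|nl ln].
  by rewrite H // /extend leqnn.
by apply: alx; rewrite nl addSnnS.
Qed.

Hypothesis m_prob : prob_row m.

Lemma law_start alive E k :
  L (alive_until alive E 0 k) =
  (\sum_i m 0%R i *
     iter k (killed_step w alive) (fun t => (alive t.1 && E t)%:R) (0%R, i))%:E.
Proof.
pose s (i : 'I_d.+1) (n : nat) : int * 'I_d.+1 := (0%R, i).
pose B i := cyl (s i) 0.
have mB i : measurable (B i) by exact: measurable_cyl.
have BE i : L (B i) = (m 0%R i)%:E by rewrite LP /init big_ord0 mulr1.
have tB : trivIset setT B.
  move=> i j _ _ [x [Bi Bj]]; have := Bi 0%N (leqnn _).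
  by rewrite (Bj 0%N (leqnn _)) => -[].
have mU : measurable (\bigcup_i B i).
  by apply: fin_bigcup_measurable => //; exact: finite_finset.
have mE := measurable_alive_until alive E 0 k.
rewrite (_ : L _ = L (alive_until alive E 0 k `\` \bigcup_i B i)
    + L (alive_until alive E 0 k `&` \bigcup_i B i)); last exact: measureDI.
rewrite [X in X + _](_ : _ = 0) ?add0e; last first.
  have null : L (~` \bigcup_i B i) = 0.
    rewrite (_ : L _ = 1 - L (setT `&` \bigcup_i B i)).
      rewrite measure_setI_finType //.
      under eq_bigr do rewrite setTI BE.
      by rewrite sumEFin m_prob.2 subee.
    by rewrite -LT -setTD; apply: measureD => //; rewrite ltey_eq law_fin_num.
  apply: (subset_measure0 _ _ _ null); [exact: measurableD|exact: measurableC|].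
  by move=> x [].
rewrite measure_setI_finType // -sumEFin; apply: eq_bigr => i _.
by rewrite setIC law_alive_until BE EFinM.
Qed.
End Link.

(** * Half lines of the environment *)

Section Depth.
Context {R : realType} {d : nat}.
Implicit Types (w : Omega R d) (c : int).

(** Depth 0 is the layer just below the target layer c. *)
Definition layer_at c (q : nat) : int := c - 1 - q%:Z.
Definition up_mx w c q := Pm w (layer_at c q).
Definition stay_mx w c q := Rm w (layer_at c q).
Definition down_mx w c q := Qm w (layer_at c q).

Definition surv w c n q : 'cV[R]_d.+1 := survival (up_mx w c) (stay_mx w c) (down_mx w c) n q.
Definition occ w n k : 'M[R]_d.+1 := occupation (up_mx w 1) (stay_mx w 1) (down_mx w 1) n k.

Lemma up_mx_ge0 w c q : lemx 0 (up_mx w c q).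
Proof. by case: (env_ok w (layer_at c q)). Qed.

Lemma stay_mx_ge0 w c q : lemx 0 (stay_mx w c q).
Proof. by case: (env_ok w (layer_at c q)). Qed.

Lemma down_mx_ge0 w c q : lemx 0 (down_mx w c q).
Proof. by case: (env_ok w (layer_at c q)). Qed.

Lemma sum_layer1 w c q :
  (up_mx w c q + stay_mx w c q + down_mx w c q) *m const_mx 1 = const_mx 1 :> 'cV[R]_d.+1.
Proof. by case: (env_ok w (layer_at c q)). Qed.

Lemma surv_ge0 w c n q i : 0 <= surv w c n q i 0.
Proof.
have := survival_ge0 (up_mx w c) (stay_mx w c) (down_mx w c) (up_mx_ge0 w c) (stay_mx_ge0 w c) (down_mx_ge0 w c) n q i 0.
by rewrite mxE.
Qed.

Lemma iter_killed_depth w c (alive : pred int) f (F : nat -> 'cV[R]_d.+1) :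
  alive c = false -> (forall q, alive (layer_at c q)) ->
  (forall q i, f (layer_at c q, i) = F q i 0) -> (forall i, f (c, i) = 0) ->
  forall n q i, iter n (killed_step w alive) f (layer_at c q, i) =
    iter n (kill (up_mx w c) (stay_mx w c) (down_mx w c)) F q i 0.
Proof.
move=> cF alT fF f0.
have at_c n i : iter n (killed_step w alive) f (c, i) = 0.
  by case: n => [|n] /=; rewrite ?f0 // /killed_step cF.
elim=> [|n IH] q i /=; first exact: fF.
rewrite {1}/killed_step alT sum_step /= [in RHS]/kill.
rewrite [RHS]mxE [X in _ = X + _]mxE; congr (_ + _ + _).
- case: q => [|q].
    rewrite big1 ?mxE // => j _.
    by rewrite (_ : layer_at c 0 + 1 = c) ?at_c ?mulr0 // /layer_at; lia.
  have -> : layer_at c q.+1 + 1 = layer_at c q by rewrite /layer_at; lia.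
  by rewrite mxE; apply: eq_bigr => j _; rewrite IH.
- by rewrite mxE; apply: eq_bigr => j _; rewrite IH.
- have -> : layer_at c q - 1 = layer_at c q.+1 by rewrite /layer_at; lia.
  by rewrite mxE; apply: eq_bigr => j _; rewrite IH.
Qed.

Lemma iter_killed_step_eq0 w (alive : pred int) f c : alive c = false ->
  (forall s : int * 'I_d.+1, s.1 <= c -> f s = 0) ->
  forall n (s : int * 'I_d.+1), s.1 <= c -> iter n (killed_step w alive) f s = 0.
Proof.
move=> cF f0; elim=> [|n IH] s sc /=; first exact: f0.
rewrite /killed_step; case: ifPn => // al; apply: big1 => t _.
rewrite IH ?mulr0 //; have sNc : s.1 <> c by move=> E; move: al; rewrite E cF.
by case: t => [[e ?] j] /=; lia.
Qed.

(** Below the target layer k+1 the depth of layer 0 is k. *)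
Lemma law_survival w m (L : {measure set (Traj d) -> \bar R}) :
  quenched_law w m L -> L setT = 1%E -> prob_row m ->
  forall k n, L (alive_until (fun p => p < k.+1%:Z) xpredT 0 n) =
    ((m *m surv w k.+1%:Z n k) 0 0)%:E.
Proof.
move=> LP LT mP k n; rewrite (law_start _ _ _ LP LT mP) mxE; congr (_%:E).
apply: eq_bigr => i _; congr (_ * _).
have {1}-> : (0 : int) = layer_at k.+1%:Z k by rewrite /layer_at; lia.
rewrite (iter_killed_depth _ _ _ _ (fun=> const_mx 1)) //.
- by move=> q; rewrite /layer_at; lia.
- by move=> q j; rewrite mxE andbT /=; have -> : layer_at k.+1%:Z q < k.+1%:Z by rewrite /layer_at; lia.
- by move=> j /=; rewrite ltxx.
Qed.

(** T_1 is the first time with xi = 1 exactly; since the walk starts at 0, killing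
    at 1 and killing on [1, +oo) agree by [killed_step_agree]. *)
Lemma law_occupation w m (L : {measure set (Traj d) -> \bar R}) :
  quenched_law w m L -> L setT = 1%E -> prob_row m ->
  forall k i n, L (alive_until (fun p => p != 1) (pred1 (- k%:Z, i)) 0 n) =
    ((m *m occ w n k) 0 i)%:E.
Proof.
move=> LP LT mP k i n; rewrite (law_start _ _ _ LP LT mP) mxE; congr (_%:E).
apply: eq_bigr => j _; congr (_ * _).
rewrite (killed_step_agree _ _ (fun p => p < 1) _ 1) //; last by move=> p; lia.
have {1}-> : (0 : int) = layer_at 1 0 by rewrite /layer_at; lia.
rewrite (iter_killed_depth _ _ _ _ (fun q => layer_id k q *m delta_mx i 0)) //.
- by rewrite iter_killMr -colE mxE.
- by move=> q; rewrite /layer_at; lia.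
- move=> q l /=; rewrite -colE mxE xpair_eqE.
  have -> : layer_at 1 q != 1 by rewrite /layer_at; lia.
  have -> : (layer_at 1 q == - k%:Z) = (q == k) by rewrite /layer_at; lia.
  by rewrite /layer_id; case: eqP => _; rewrite mxE.
Qed.

(** Killed at layer 1, the walk never gets above it. *)
Lemma law_above w m (L : {measure set (Traj d) -> \bar R}) :
  quenched_law w m L -> L setT = 1%E -> prob_row m ->
  forall k i n, L (alive_until (fun p => p != 1) (pred1 (k.+1%:Z, i)) 0 n) = 0%E.
Proof.
move=> LP LT mP k i n; rewrite (law_start _ _ _ LP LT mP) big1 // => j _.
rewrite (iter_killed_step_eq0 _ _ _ 1) ?mulr0 // => s s1.
case: eqP => //= s1'; case: eqP => //= E; move: s1 s1'; rewrite E /=; lia.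
Qed.

(** The hitting equation, by decomposition according to the first step. *)
Lemma is_zeta_hitting w z n : is_zeta w z ->
  z n = Pm w n + Rm w n *m z n + Qm w n *m z (n - 1) *m z n.
Proof.
move=> /(_ n) [_ u zE].
have : resolvent_arg w z n *m z n = Pm w n by rewrite zE mulmxA mulmxV // mul1mx.
by rewrite /resolvent_arg !mulmxBl mul1mx => <-; rewrite !subrK.
Qed.

(** For each n the two solutions are compared on the half line below layer
    n + 1. *)
Lemma is_zeta_unique w z z' : is_zeta w z -> is_zeta w z' ->
  (forall c i, (fun n => surv w c n 0 i 0) @ \oo --> (0 : R)) -> z = z'.
Proof.
move=> zP z'P s0; apply/funext => n.
have -> : n = layer_at (n + 1) 0 by rewrite /layer_at; lia.
have hz x : is_zeta w x -> forall q, x (layer_at (n + 1) q) = up_mx w (n + 1) q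
   + stay_mx w (n + 1) q *m x (layer_at (n + 1) q)
   + down_mx w (n + 1) q *m x (layer_at (n + 1) q.+1) *m x (layer_at (n + 1) q).
  move=> xP q; rewrite {1}(is_zeta_hitting _ _ _ xP); congr (_ + _ *m x _ *m _).
  by rewrite /layer_at; lia.
apply: (hitting_unique (up_mx w (n + 1)) (stay_mx w (n + 1)) (down_mx w (n + 1)) _ _ _
  (fun q => z (layer_at (n + 1) q)) (fun q => z' (layer_at (n + 1) q))).
- exact: up_mx_ge0.
- exact: stay_mx_ge0.
- exact: down_mx_ge0.
- by move=> q; case: (zP (layer_at (n + 1) q)).
- by move=> q; case: (z'P (layer_at (n + 1) q)).
- exact: hz.
- exact: hz.
- exact: s0.
Qed.

Definition green_row w (z : int -> 'M[R]_d.+1) (m : 'rV[R]_d.+1) k : 'rV[R]_d.+1 :=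
  m *m (\prod_(l < k) Amx w z (- l%:Z)) *m utilde w z (- k%:Z).

Lemma occ_series w z m k i : is_zeta w z -> prob_row m ->
  (forall n i, 0 < \sum_j Pm w n i j) ->
  (fun n => (m *m surv w 1 n 0) 0 0) @ \oo --> (0 : R) ->
  (fun N => \sum_(n < N) (m *m occ w n k) 0 i) @ \oo --> green_row w z m k 0 i.
Proof.
move=> zP [m0 m1] P0 s0.
pose zd q := z (layer_at 1 q).
have invE q : green_inv (stay_mx w 1) (down_mx w 1) zd q = resolvent_arg w z (layer_at 1 q).
  rewrite /green_inv /resolvent_arg /zd.
  by have -> : layer_at 1 q.+1 = layer_at 1 q - 1 by rewrite /layer_at; lia.
have lE q : layer_at 1 q = - q%:Z by rewrite /layer_at; lia.
have -> : green_row w z m k = green (stay_mx w 1) (down_mx w 1) zd m k.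
  rewrite /green_row /green /green_local invE lE; congr (_ *m _ *m _).
  apply: eq_bigr => l _; rewrite /green_step /green_local invE lE.
  by rewrite /down_mx lE.
apply: occupation_series.
- exact: up_mx_ge0.
- exact: stay_mx_ge0.
- exact: down_mx_ge0.
- exact: sum_layer1.
- by move=> q; case: (zP (layer_at 1 q)).
- by move=> q; rewrite invE; case: (zP (layer_at 1 q)).
- by move=> q; rewrite /green_local invE; case: (zP (layer_at 1 q)).
- by move=> q j; exact: P0.
- by move=> a b; rewrite ord1 mxE.
- apply/matrixP => a b; rewrite !ord1 mxE [RHS]mxE -[RHS]m1.
  by apply: eq_bigr => j _; rewrite mxE mulr1.
- exact: s0.
Qed.

Lemma utilde_ge0 w z n : is_zeta w z -> (forall n i, 0 < \sum_j Pm w n i j) ->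
  lemx 0 (utilde w z n).
Proof.
move=> zP P0.
pose zd q := z (layer_at (n + 1) q).
have -> : utilde w z n = green_local (stay_mx w (n + 1)) (down_mx w (n + 1)) zd 0.
  have E0 : layer_at (n + 1) 0 = n by rewrite /layer_at; lia.
  have E1 : layer_at (n + 1) 1 = n - 1 by rewrite /layer_at; lia.
  by rewrite /green_local /green_inv /zd /stay_mx /down_mx E0 E1.
have invE q : green_inv (stay_mx w (n + 1)) (down_mx w (n + 1)) zd q
    = resolvent_arg w z (layer_at (n + 1) q).
  rewrite /green_inv /resolvent_arg /zd.
  by have -> : layer_at (n + 1) q.+1 = layer_at (n + 1) q - 1 by rewrite /layer_at; lia.
apply: (green_local_ge0 (up_mx w (n + 1))).
- exact: stay_mx_ge0.
- exact: down_mx_ge0.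
- exact: sum_layer1.
- by move=> q; case: (zP (layer_at (n + 1) q)).
- by move=> q; rewrite invE; case: (zP (layer_at (n + 1) q)).
- by move=> q i; exact: P0.
Qed.

Lemma series_term_ge0 w z k : is_zeta w z -> (forall n i, 0 < \sum_j Pm w n i j) ->
  lemx 0 (series_term w z k).
Proof.
move=> zP P0.
have prod_ge0 (F : 'I_k -> 'M[R]_d.+1) : (forall l, lemx 0 (F l)) -> lemx 0 (\prod_l F l).
  move=> F0; elim/big_ind: _ => [|A B|l _] //; last exact: mx_ge0M.
  by move=> i j; rewrite !mxE ler0n.
have u0 n : lemx 0 (utilde w z n) by exact: utilde_ge0.
apply: mx_ge0M => //; apply: mx_ge0M; apply: prod_ge0 => l.
  by case: (zP l%:Z) => /stochastic_mxP[].
by apply: mx_ge0M => //; case: (env_ok w (k%:Z - l%:Z)).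
Qed.

Lemma Pm_shift w k n : Pm (theta k w) n = Pm w (n + k). Proof. by []. Qed.
Lemma Qm_shift w k n : Qm (theta k w) n = Qm w (n + k). Proof. by []. Qed.
Lemma Rm_shift w k n : Rm (theta k w) n = Rm w (n + k). Proof. by []. Qed.

Lemma surv_shift w k c n q : surv (theta k w) c n q = surv w (c + k) n q.
Proof.
rewrite /surv; have E r : layer_at c r + k = layer_at (c + k) r by rewrite /layer_at; lia.
by congr (survival _ _ _ _ _); apply/funext => r; rewrite /up_mx /stay_mx /down_mx /Pm /Qm /Rm /Defs.shift E.
Qed.

Lemma is_zeta_shift w z k : is_zeta w z -> is_zeta (theta k w) (fun n => z (n + k)).
Proof.
move=> zP n.
have E : resolvent_arg (theta k w) (fun n => z (n + k)) n = resolvent_arg w z (n + k).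
  by rewrite /resolvent_arg Qm_shift Rm_shift (addrAC n).
by case: (zP (n + k)) => *; rewrite /utilde E.
Qed.

(** With the walk in theta^k w and zeta taken from w, the factors become
    A_k ... A_1 u~_0. *)
Lemma green_row_shift w z m k :
  green_row (theta k%:Z w) (fun n => z (n + k%:Z)) m k =
  m *m (\prod_(l < k) Amx w z (k%:Z - l%:Z)) *m utilde w z 0.
Proof.
have E n : resolvent_arg (theta k%:Z w) (fun n => z (n + k%:Z)) n = resolvent_arg w z (n + k%:Z).
  by rewrite /resolvent_arg Qm_shift Rm_shift (addrAC n).
rewrite /green_row /utilde E addNr; congr (_ *m _ *m _).
by apply: eq_bigr => l _; rewrite /Amx /utilde E Qm_shift addrC.
Qed.

End Depth.

(** * Measurability and stationarity *)

Section MeasurableMatrices.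
Context {R : realType} {disp : measure_display} {T : measurableType disp}.

Definition measurable_mx m n (A : T -> 'M[R]_(m, n)) :=
  forall i j, measurable_fun setT (fun x => A x i j).

Lemma measurable_mx_eq m n (A B : T -> 'M[R]_(m, n)) :
  A = B -> measurable_mx m n A -> measurable_mx m n B.
Proof. by move=> ->. Qed.

Lemma measurable_mx_cst m n (A : 'M[R]_(m, n)) : measurable_mx m n (fun=> A).
Proof. by move=> i j; exact: measurable_cst. Qed.

Lemma measurable_mxD m n (A B : T -> 'M[R]_(m, n)) :
  measurable_mx m n A -> measurable_mx m n B -> measurable_mx m n (fun x => A x + B x).
Proof.
move=> mA mB i j; under eq_fun do rewrite mxE.
exact: measurable_funD.
Qed.

Lemma measurable_mxB m n (A B : T -> 'M[R]_(m, n)) :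
  measurable_mx m n A -> measurable_mx m n B -> measurable_mx m n (fun x => A x - B x).
Proof.
move=> mA mB i j; under eq_fun do rewrite !mxE.
exact: measurable_funB.
Qed.

Lemma measurable_mxM m n p (A : T -> 'M[R]_(m, n)) (B : T -> 'M[R]_(n, p)) :
  measurable_mx m n A -> measurable_mx n p B -> measurable_mx m p (fun x => A x *m B x).
Proof.
move=> mA mB i j; under eq_fun do rewrite mxE.
by apply: measurable_sum => k; exact: measurable_funM.
Qed.

Lemma measurable_mx_prod n k (A : nat -> T -> 'M[R]_n.+1) :
  (forall l, measurable_mx n.+1 n.+1 (A l)) ->
  measurable_mx n.+1 n.+1 (fun x => \prod_(l < k) A l x).
Proof.
move=> mA; elim: k => [|k IH].
  apply: measurable_mx_eq (measurable_mx_cst _ _ 1%:M).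
  by apply/funext => x; rewrite big_ord0.
apply: measurable_mx_eq (measurable_mxM _ _ _ _ _ IH (mA k)).
by apply/funext => x; rewrite big_ord_recr.
Qed.

Lemma measurable_det n (A : T -> 'M[R]_n) :
  measurable_mx n n A -> measurable_fun setT (fun x => \det (A x)).
Proof.
move=> mA; apply: measurable_sum => s; apply: measurable_funM => //.
by apply: measurable_prod => i _; exact: mA.
Qed.

Lemma measurable_invr : measurable_fun setT (fun x : R => x^-1).
Proof.
have -> : (fun x : R => x^-1) = (fun x => x * (x ^+ 2) `^ (- 1)).
  apply/funext => x; rewrite powR_inv1 ?sqr_ge0 //.
  have [->|x0] := eqVneq x 0; first by rewrite mul0r invr0.
  by rewrite expr2 invfM mulrA divff // mul1r.
apply: measurable_funM => //.
exact: (measurableT_comp (measurable_powR (- 1)) (exprn_measurable 2)).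
Qed.

Lemma measurable_invmx n (A : T -> 'M[R]_n.+1) :
  measurable_mx n.+1 n.+1 A -> measurable_mx n.+1 n.+1 (fun x => invmx (A x)).
Proof.
move=> mA i j.
have -> : (fun x => invmx (A x) i j) = (fun x => if \det (A x) == 0 then A x i j
    else (\det (A x))^-1 * cofactor (A x) j i).
  apply/funext => x; rewrite /invmx unitmxE unitfE; case: eqP => //= _.
  by rewrite 2!mxE.
have mdet := measurable_det _ _ mA.
apply: measurable_fun_ifT.
- exact: measurable_fun_eqr.
- exact: mA.
- apply: measurable_funM; first exact: (measurableT_comp measurable_invr).
  apply: measurable_funM => //; apply: measurable_det => k l.
  by under eq_fun do rewrite !mxE; exact: mA.
Qed.

(** The sequences which converge form a measurable set, where the limit is the
    upper limit; elsewhere the limit operator returns a fixed value. *)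
Lemma measurable_limn (f : nat -> T -> \bar R) :
  (forall n, measurable_fun setT (f n)) ->
  measurable_fun setT (fun x => limn (f ^~ x)).
Proof.
move=> mf.
have mf_inf : measurable_fun setT (fun x => limn_einf (f ^~ x)).
  have -> : (fun x => limn_einf (f ^~ x)) =
     (fun x => - limn_esup ((fun n x => - f n x) ^~ x))%E.
    by [].
  apply: measurableT_comp => //; apply: measurable_fun_limn_esup => n.
  by apply: measurableT_comp => //.
have mf_sup : measurable_fun setT (fun x => limn_esup (f ^~ x)).
  exact: measurable_fun_limn_esup.
have -> : (fun x => limn (f ^~ x)) = (fun x =>
    if (limn_einf (f ^~ x) == limn_esup (f ^~ x))%E then limn_esup (f ^~ x) else point).
  apply/funext => x; case: eqP => [E|NE].
    apply/cvg_lim => //; apply: (@squeeze_cvge _ _ _ _ (einfs (f ^~ x)) _ (esups (f ^~ x))).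
    - near=> n; apply/andP; split; first by apply: ereal_inf_lbound; exists n => /=.
      by apply: ereal_sup_ubound; exists n => /=.
    - by rewrite -E limn_einf_lim; exact: is_cvg_einfs.
    - by rewrite limn_esup_lim; exact: is_cvg_esups.
  apply: dvgP => cvgf; apply: NE.
  by rewrite is_cvg_limn_einfE // is_cvg_limn_esupE.
apply: measurable_fun_ifT => //; apply: (measurable_fun_bool true).
rewrite [X in measurable X](_ : _ = setT `&` [set x |
    limn_einf (f ^~ x) = limn_esup (f ^~ x)]); first exact: measurable_eqe.
by congr (_ `&` _); apply/seteqP; split => x /= /eqP.
Unshelve. all: by end_near.
Qed.

End MeasurableMatrices.

Section MeasurableEnvironment.
Context {R : realType} {d : nat}.

Lemma measurable_Pm n : measurable_mx d.+1 d.+1 (fun w : Omega R d => Pm w n).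
Proof.
move=> i j _ B mB; rewrite setTI; apply: sub_sigma_algebra.
by exists n, i, j, B; split => //; apply: Or31.
Qed.

Lemma measurable_Qm n : measurable_mx d.+1 d.+1 (fun w : Omega R d => Qm w n).
Proof.
move=> i j _ B mB; rewrite setTI; apply: sub_sigma_algebra.
by exists n, i, j, B; split => //; apply: Or32.
Qed.

Lemma measurable_Rm n : measurable_mx d.+1 d.+1 (fun w : Omega R d => Rm w n).
Proof.
move=> i j _ B mB; rewrite setTI; apply: sub_sigma_algebra.
by exists n, i, j, B; split => //; apply: Or33.
Qed.

Lemma measurable_theta k : measurable_fun setT (theta k : Omega R d -> Omega R d).
Proof.
eapply (@measurability _ _ (Omega R d) (Omega R d) setT (theta k) (@env_cylinders R d) erefl).
move=> A [C [n [i [j [B [mB cyl]]]]] <-]; rewrite setTI.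
case: cyl => ->.
- by have := measurable_Pm (n + k) i j measurableT B mB; rewrite setTI.
- by have := measurable_Qm (n + k) i j measurableT B mB; rewrite setTI.
- by have := measurable_Rm (n + k) i j measurableT B mB; rewrite setTI.
Qed.

Lemma theta_add (a b : int) (w : Omega R d) : theta a (theta b w) = theta (a + b) w.
Proof. by apply/funext => n; rewrite /Defs.shift addrA. Qed.

Lemma theta0 (w : Omega R d) : theta 0 w = w.
Proof. by apply/funext => n; rewrite /Defs.shift addr0. Qed.

Lemma preimage_theta (a b : int) (B : set (Omega R d)) :
  theta b @^-1` (theta a @^-1` B) = theta (a + b) @^-1` B.
Proof. by apply/seteqP; split=> w; rewrite /preimage /= theta_add. Qed.

Lemma preimage_theta0 (B : set (Omega R d)) : theta 0 @^-1` B = B.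
Proof. by apply/seteqP; split=> w; rewrite /preimage /= theta0. Qed.

Lemma measurable_surv c n q :
  measurable_mx d.+1 1 (fun w : Omega R d => surv w c n q).
Proof.
elim: n q => [|n IH] q; first exact: measurable_mx_cst.
have mSD : measurable_mx d.+1 1 (fun w : Omega R d =>
    stay_mx w c q *m surv w c n q + down_mx w c q *m surv w c n q.+1).
  apply: measurable_mxD; apply: measurable_mxM => //.
    exact: measurable_Rm.
  exact: measurable_Qm.
case: q mSD => [|q] mSD.
  apply: measurable_mx_eq mSD; apply/funext => w.
  by rewrite [RHS]/surv /survival /= /kill add0r.
have mU : measurable_mx d.+1 1 (fun w : Omega R d => up_mx w c q.+1 *m surv w c n q).
  by apply: measurable_mxM => //; exact: measurable_Pm.
apply: measurable_mx_eq (measurable_mxD _ _ _ _ mU mSD); apply/funext => w.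
by rewrite [RHS]/surv /survival /= /kill addrA.
Qed.

Lemma measurable_step (s t : int * 'I_d.+1) :
  measurable_fun setT (fun w : Omega R d => step w s t).
Proof.
rewrite /step; have [_|_] := boolP (t.1 == s.1 + 1); first exact: measurable_Pm.
have [_|_] := boolP (t.1 == s.1); first exact: measurable_Rm.
have [_|_] := boolP (t.1 == s.1 - 1); first exact: measurable_Qm.
exact: measurable_cst.
Qed.

(** Countably many finite paths decide communication. *)
Lemma measurable_layer0_one_class :
  measurable [set w : Omega R d | layer0_one_class w].
Proof.
have mpath s (p : seq (int * 'I_d.+1)) :
    measurable [set w : Omega R d | path (fun a b => 0 < step w a b) s p].
  elim: p s => [|t p IH] s /=; first by have -> : [set w : Omega R d | true] = setT by apply/seteqP.
  have -> : [set w : Omega R d | (0 < step w s t) && path (fun a b => 0 < step w a b) t p] =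
     [set w | 0 < step w s t] `&` [set w | path (fun a b => 0 < step w a b) t p].
    by apply/seteqP; split => w /= => [/andP[]|[-> ->]].
  apply: measurableI; last exact: IH.
  have := measurable_step s t measurableT `]0, +oo[%classic (measurable_itv _).
  by rewrite setTI; congr measurable; apply/seteqP; split => w /=; rewrite in_itv /= andbT.
have -> : [set w : Omega R d | layer0_one_class w] =
    \bigcap_(ij in [set: 'I_d.+1 * 'I_d.+1]) \bigcup_(p in [set: seq (int * 'I_d.+1)])
      (if last (0, ij.1) p == (0, ij.2)
       then [set w | path (fun a b => 0 < step w a b) (0, ij.1) p] else set0).
  apply/seteqP; split => w /=.
    move=> H [i j] _; have [p [pp pl]] := H i j.
    by exists p => //; rewrite pl eqxx.
  move=> H i j; have [p _] := H (i, j) I; case: eqP => //= pl pp.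
  by exists p.
apply: fin_bigcap_measurable => [|ij _]; first exact: finite_finset.
apply: countable_bigcupT_measurable => [|p]; first exact: countableP.
by case: ifP => _.
Qed.

Variable P : probability (Omega R d) R.
Hypothesis Pstat : stationary P.

Lemma stationary_theta (k : int) (B : set (Omega R d)) : measurable B ->
  P (theta k @^-1` B) = P B.
Proof.
move=> mB.
have mth a : measurable (theta a @^-1` B).
  by rewrite -[X in measurable X]setTI; exact: measurable_theta.
case: k => n.
  elim: n => [|n IH]; first by rewrite preimage_theta0.
  rewrite -IH -(Pstat (theta n @^-1` B)) // preimage_theta.
  by have -> : n%:Z + 1 = n.+1 by lia.
elim: n => [|n IH].
  rewrite -(Pstat (theta _ @^-1` B)) // preimage_theta.
  have -> : Negz 0 + 1 = 0 by lia.
  by rewrite preimage_theta0.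
rewrite -IH -(Pstat (theta _ @^-1` B)) // preimage_theta.
by have -> : Negz n.+1 + 1 = Negz n by lia.
Qed.

Lemma ae_theta (k : int) (Q : set (Omega R d)) :
  {ae P, forall w, Q w} -> {ae P, forall w, Q (theta k w)}.
Proof.
move=> [N [mN N0 QN]]; exists (theta k @^-1` N); split.
- by rewrite -[X in measurable X]setTI; exact: measurable_theta.
- by rewrite stationary_theta.
- by move=> w /= nQ; apply: QN.
Qed.

Lemma ae_all_theta (Q : set (Omega R d)) :
  {ae P, forall w, Q w} -> {ae P, forall w, forall k : int, Q (theta k w)}.
Proof.
move=> aeQ.
have Hn : {ae P, forall w, forall n : nat, Q (theta n%:Z w) /\ Q (theta (Negz n) w)}.
  apply: ae_foralln => n; have h1 := ae_theta n%:Z _ aeQ; have h2 := ae_theta (Negz n) _ aeQ.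
  by apply: filterS2 h1 h2.
by apply: filterS Hn => w H [] n; case: (H n).
Qed.

Lemma integral_theta (k : int) (f : Omega R d -> \bar R) :
  measurable_fun setT f -> (forall w, (0 <= f w)%E) ->
  (\int[P]_w f w = \int[P]_w f (theta k w))%E.
Proof.
move=> mf f0.
have mth := measurable_theta k.
rewrite -[RHS](ge0_integral_pushforward mth _ measurableT) //.
apply: eq_measure_integral => B mB _.
exact: (esym (stationary_theta k B mB)).
Qed.

End MeasurableEnvironment.

(** * Reaching every layer to the right *)

Section Reaching.
Context {R : realType} {d : nat}.
Implicit Types (w : Omega R d) (c : int) (s t : int * 'I_d.+1).

(** Probability of staying below layer c during n steps, from a state s at any
    layer; [surv] is the same in depth coordinates. *)
Definition stay_below w c n s : R :=
  iter n (killed_step w (fun p => p < c)) (fun s => ((s.1 < c)%R : bool)%:R) s.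

Definition reaches w c s : Prop := (fun n => stay_below w c n s) @ \oo --> (0 : R).

Lemma stay_below_ge0 w c n s : 0 <= stay_below w c n s.
Proof. by apply: iter_killed_step_ge0 => t; rewrite ler0n. Qed.

Lemma stay_below_surv w c n q i :
  stay_below w c n (layer_at c q, i) = surv w c n q i 0.
Proof.
rewrite /stay_below (iter_killed_depth _ _ _ _ (fun=> const_mx 1)) //.
- by move=> p; rewrite /layer_at; lia.
- move=> p j; rewrite mxE /=.
  by have -> : layer_at c p < c by rewrite /layer_at; lia.
- by move=> j; rewrite /= ltxx.
Qed.

Lemma stay_below_le w c c' n s : c <= c' -> stay_below w c n s <= stay_below w c' n s.
Proof.
move=> cc'; elim: n s => [|n IH] s /=.
  rewrite ler_nat; case: (ltP s.1 c) => // sc.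
  by rewrite (lt_le_trans sc cc').
rewrite /stay_below /= /killed_step; case: ifPn => sc.
  rewrite (lt_le_trans sc cc'); apply: ler_sum => t _.
  by apply: ler_wpM2l (IH _); exact: step_ge0.
case: ifP => _ //; apply: sumr_ge0 => t _.
by rewrite mulr_ge0 ?step_ge0 // stay_below_ge0.
Qed.

Lemma reaches_le w c c' s : c <= c' -> reaches w c' s -> reaches w c s.
Proof.
move=> cc' h; apply: (@squeeze_cvgr _ _ _ _ (fun=> 0) (fun n => stay_below w c' n s)) => //.
  by near=> n; rewrite stay_below_ge0 stay_below_le.
exact: cvg_cst.
Unshelve. all: by end_near.
Qed.

Lemma step_gt0_nbr w s t : 0 < step w s t -> exists e, t = nbr s e.
Proof.
rewrite /step; case: s t => [a i] [b j] /=.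
case: eqP => [-> _|_].
  by exists (inord 2, j); rewrite /nbr /= inordK //; congr (_, _); lia.
case: eqP => [-> _|_].
  by exists (inord 1, j); rewrite /nbr /= inordK //; congr (_, _); lia.
case: eqP => [-> _|_]; last by rewrite ltxx.
by exists (inord 0, j); rewrite /nbr /= inordK //; congr (_, _); lia.
Qed.

(** Quantifying over all c makes the property propagate along a step that
    overshoots c: the target is first raised above s. *)
Lemma reaches_step w s t : 0 < step w s t ->
  (forall c, reaches w c s) -> forall c, reaches w c t.
Proof.
move=> st sd c; pose c' := Num.max c (s.1 + 1).
apply: (@reaches_le _ _ c'); first by rewrite le_max lexx.
have sc : s.1 < c' by rewrite lt_max; apply/orP; right; lia.
apply: (@squeeze_cvgr _ _ _ _ (fun=> 0)
  (fun n => (step w s t)^-1 * stay_below w c' n.+1 s)).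
- near=> n; rewrite stay_below_ge0 /= ler_pdivlMl //.
  have [e te] := step_gt0_nbr _ _ _ st.
  rewrite /stay_below /= {2}/killed_step sc (bigD1 e) //= -te lerDl.
  apply: sumr_ge0 => e' _; rewrite mulr_ge0 ?step_ge0 //.
  exact: stay_below_ge0.
- exact: cvg_cst.
- rewrite -[X in _ --> X](mulr0 (step w s t)^-1); apply: cvgMr.
  by have := sd c'; rewrite /reaches -(cvg_shiftS (fun n => stay_below w c' n s)).
Unshelve. all: by end_near.
Qed.

Lemma reaches_leads_to w s t : leads_to w s t ->
  (forall c, reaches w c s) -> forall c, reaches w c t.
Proof.
move=> [p [+ <-]]; elim: p s => //= u p IH s /andP[su up] sd.
by apply: IH up _; exact: reaches_step su sd.
Qed.

Definition hits_right w := forall (k : nat) i,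
  (fun n => surv w k.+1%:Z n k i 0) @ \oo --> (0 : R).

Lemma hits_rightP w : hits_right w <-> forall i c, reaches w c (0, i).
Proof.
have E (k : nat) : layer_at k.+1%:Z k = 0 by rewrite /layer_at; lia.
split=> [h i c|h k i]; last first.
  have := h i k.+1%:Z; rewrite /reaches -(E k).
  by under eq_fun do rewrite stay_below_surv.
apply: (@reaches_le _ _ `|c|.+1%:Z); first by lia.
rewrite /reaches -(E `|c|%N).
by under eq_fun do rewrite stay_below_surv; exact: h.
Qed.

Definition entered_from_left w := forall (n : int) j, 0 < \sum_i Pm w n i j.

(** Columns of P are non-zero: every state of layer 1 is entered from layer 0. *)
Lemma hits_right_theta1 w : entered_from_left w -> hits_right w -> hits_right (theta 1 w).
Proof.
move=> colP /hits_rightP h k j.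
have [i Pij] : exists i, 0 < Pm w 0 i j.
  apply/not_existsP => H; have := colP 0 j; rewrite ltNge => /negP; apply.
  by apply: sumr_le0 => i _; rewrite leNgt; apply/negP; exact: H.
have st : 0 < step w (0, i) (1, j) by rewrite /step.
have := reaches_step w _ _ st (h i) (k.+1%:Z + 1); rewrite /reaches.
have -> : (1, j) = (layer_at (k.+1%:Z + 1) k, j).
  by congr (_, _); rewrite /layer_at; lia.
under eq_fun do rewrite stay_below_surv.
by under [X in _ -> X @ _ --> _]eq_fun do rewrite surv_shift.
Qed.

Lemma hits_right_all_layers w : (forall k, hits_right (theta k w)) ->
  forall c i, (fun n => surv w c n 0 i 0) @ \oo --> (0 : R).
Proof.
move=> h c i; have := h (c - 1) 0%N i.
under eq_fun do rewrite surv_shift.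
by have -> : 1%:Z + (c - 1) = c by lia.
Qed.

(** The difference of consecutive terms is the exit flux of [survivalS]. *)
Lemma surv_nonincreasing w c q i : nonincreasing_seq (fun n => surv w c n q i 0).
Proof.
apply/nonincreasing_seqP => n.
rewrite /surv [leRHS](congr1 (fun A : 'cV_d.+1 => A i 0) (survivalS _ _ _ (sum_layer1 w c) n q)).
rewrite [leRHS]mxE lerDl.
have H : lemx 0 (iter n (kill (up_mx w c) (stay_mx w c) (down_mx w c)) (layer_id 0) q
    *m (up_mx w c 0 *m const_mx 1 : 'cV_d.+1)).
  apply: mx_ge0M; first apply: iter_kill_ge0.
  - exact: up_mx_ge0.
  - exact: stay_mx_ge0.
  - exact: down_mx_ge0.
  - exact: layer_id_ge0.
  - by apply: mx_ge0M; [exact: up_mx_ge0|move=> ? ?; rewrite !mxE ler01].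
by have := H i 0; rewrite [X in X <= _]mxE.
Qed.

(** Reduces a limit to countably many conditions, for measurability. *)
Lemma cvg0_nonincreasing (u : nat -> R) : nonincreasing_seq u -> (forall n, 0 <= u n) ->
  (u @ \oo --> (0 : R)) <-> forall m, exists n, u n < m.+1%:R^-1.
Proof.
move=> du u0; split=> [uc m|H].
  have m0 : 0 < m.+1%:R^-1 :> R by rewrite invr_gt0.
  have : \forall n \near \oo, u n < m.+1%:R^-1 by apply: cvgr_lt uc _ m0.
  by move=> [N _ /(_ N (leqnn _))]; exists N.
apply/cvgr0Pnorm_lt => e e0.
have [m _ me] := near_infty_natSinv_lt (PosNum e0).
have {}me : m.+1%:R^-1 < e by exact: (me m (leqnn m)).
have [N uN] := H m; near=> n; rewrite ger0_norm //.
apply: le_lt_trans (lt_trans uN me); apply: du.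
by near: n; exact: nbhs_infty_ge.
Unshelve. all: by end_near.
Qed.

Lemma measurable_hits_right : measurable [set w : Omega R d | hits_right w].
Proof.
have -> : [set w : Omega R d | hits_right w] =
   \bigcap_k \bigcap_(i in [set: 'I_d.+1]) \bigcap_m \bigcup_n
      [set w : Omega R d | surv w k.+1%:Z n k i 0 < m.+1%:R^-1].
  apply/seteqP; split=> w /= h.
    move=> k _ i _ m _; have /cvg0_nonincreasing H := h k i.
    have [|n|n nm] := H _ _ m; [exact: surv_nonincreasing|exact: surv_ge0|by exists n].
  move=> k i; apply/cvg0_nonincreasing => [|n|m].
  - exact: surv_nonincreasing.
  - exact: surv_ge0.
  - by have [n _ ?] := h k I i I m I; exists n.
apply: bigcapT_measurable => k; apply: fin_bigcap_measurable => [|i _]; first exact: finite_finset.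
apply: bigcapT_measurable => m; apply: bigcupT_measurable => n.
have := @measurable_surv R d k.+1%:Z n k i 0 measurableT `]-oo, m.+1%:R^-1[%classic (measurable_itv _).
by rewrite setTI; congr measurable; apply/seteqP; split => w /=; rewrite in_itv.
Qed.

Lemma measurable_entered_from_left : measurable [set w : Omega R d | entered_from_left w].
Proof.
have -> : [set w : Omega R d | entered_from_left w] =
   \bigcap_(n in [set: int]) \bigcap_(j in [set: 'I_d.+1]) [set w : Omega R d | 0 < \sum_i Pm w n i j].
  by apply/seteqP; split=> w /= h; [move=> n _ j _; exact: h|move=> n j; exact: h].
rewrite -[X in measurable X]setCK setC_bigcap; apply: measurableC.
apply: countable_bigcupT_measurable => [|n]; first exact: countableP.
apply: measurableC; apply: fin_bigcap_measurable => [|j _]; first exact: finite_finset.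
have mf : measurable_fun setT (fun w : Omega R d => \sum_i Pm w n i j).
  by apply: measurable_sum => i; exact: measurable_Pm.
have := mf measurableT `]0, +oo[%classic (measurable_itv _).
by rewrite setTI; congr measurable; apply/seteqP; split => w /=; rewrite in_itv /= andbT.
Qed.

Variable P : probability (Omega R d) R.
Hypothesis Pstat : stationary P.
Hypothesis Perg : ergodic P.

(** The preimages of A under theta^n increase, all with the probability of A, and
    their union is strictly invariant. *)
Lemma ergodic_forward_invariant (A : set (Omega R d)) : measurable A ->
  (0 < P A)%E -> A `<=` theta 1 @^-1` A -> P A = 1%E.
Proof.
move=> mA A0 A1.
pose F (n : nat) := theta n%:Z @^-1` A.
have mF n : measurable (F n).
  by rewrite -[X in measurable X]setTI; exact: measurable_theta.
have ndF : nondecreasing_seq F.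
  apply/nondecreasing_seqP => n; rewrite subsetEset /F => w /= Aw.
  by have := A1 _ Aw; rewrite /preimage /= theta_add (_ : 1 + n%:Z = n.+1%:Z) //; lia.
have Fcvg : P (F n) @[n --> \oo] --> P (\bigcup_n F n).
  exact: (nondecreasing_cvg_mu mF (bigcupT_measurable _ mF) ndF).
have PF n : P (F n) = P A by exact: stationary_theta.
have PU : P (\bigcup_n F n) = P A.
  rewrite -(cvg_lim _ Fcvg) //; apply: cvg_lim => //.
  by under eq_fun do rewrite PF; exact: cvg_cst.
have : theta 1 @^-1` (\bigcup_n F n) = \bigcup_n F n.
  have S n : theta 1 @^-1` (F n) = F n.+1.
    by rewrite /F preimage_theta (_ : n%:Z + 1 = n.+1%:Z) //; lia.
  apply/seteqP; split=> w.
    by move=> [n _ /=]; rewrite -[F n _]/((theta 1 @^-1` F n) w) S => H; exists n.+1.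
  move=> [n _ Fw]; exists n => //; rewrite -[F n _]/((theta 1 @^-1` F n) w) S.
  by have := ndF n n.+1 (leqnSn _); rewrite subsetEset; apply.
move=> /(Perg _ (bigcupT_measurable _ mF)) []; rewrite PU //.
by move=> E; rewrite E ltxx in A0.
Qed.

End Reaching.

(** * Rows of P do not vanish *)

Section SimpleFunctionBound.
Import HBNNSimple.

(** The integral of a non-negative function, measurable or not, dominates those
    of the multiples of the indicator of N which lie below it. *)
Lemma ae_not_infty d (T : measurableType d) (R : realType)
    (m : {measure set T -> \bar R}) (f : T -> \bar R) (N : set T) :
  measurable N -> (forall x, (0 <= f x)%E) -> (forall x, N x -> f x = +oo%E) ->
  (\int[m]_x f x < +oo)%E -> m N = 0%E.
Proof.
move=> mN f0 fN fi.
have le_M (M : nat) : (M%:R%:E * m N <= \int[m]_x f x)%E.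
  have M0 : 0 <= M%:R :> R by [].
  pose h := scale_nnsfun (indic_nnsfun R mN) M0.
  have <- : sintegral m h = (M%:R%:E * m N)%E.
    by rewrite -[m N]sintegral_indic -(sintegralrM _ _ (indic_nnsfun R mN)).
  rewrite ge0_integralTE //; apply: ereal_sup_ubound; exists h => //= x.
  rewrite mindicE; case: (boolP (x \in N)) => [xN|_].
    by rewrite fN ?leey //; exact/set_mem.
  by rewrite mulr0.
have mN0 : (0 <= m N)%E by exact: measure_ge0.
case: (m N) mN0 le_M => [r| |] // r0 le_M.
  have [->//|rN0] := eqVneq r 0.
  have r_gt0 : 0 < r by rewrite lt_def rN0 /= -lee_fin.
  have i0 : (0 <= \int[m]_x f x)%E by apply: integral_ge0 => x _; exact: f0.
  move: i0 fi le_M; case: (\int[m]_x f x)%E => [I| |] // i0 _ le_M.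
  have [n _ /(_ n (leqnn n)) H] := nbhs_infty_ger (I / r + 1).
  have := le_M n; rewrite -EFinM lee_fin leNgt => /negP []. 
  rewrite -ltr_pdivrMr //; apply: lt_le_trans H; lra.
have := le_M 1%N; rewrite mul1e leye_eq => /eqP E.
by move: fi; rewrite E.
Qed.

End SimpleFunctionBound.

Section PositiveRows.
Context {R : realType} {d : nat}.
Variable P : probability (Omega R d) R.

(** The rows of P + Q + R have sum 1, so a row of R + Q has sum 1 exactly when
    the row of P vanishes. *)
Lemma rownorm_RQ (w : Omega R d) n :
  0 <= mx_rownorm (Rm w n + Qm w n) <= 1 /\
  (forall i, \sum_j Pm w n i j = 0 -> mx_rownorm (Rm w n + Qm w n) = 1).
Proof.
have [p0 q0 r0 /matrixP E] := env_ok w n.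
have rowE i : \sum_j `|(Rm w n + Qm w n) i j| = 1 - \sum_j Pm w n i j.
  have := E i 0; rewrite -addrA mulmxDl mxE !mulmx_ones [RHS]mxE => E1.
  rewrite -[X in _ = X - _]E1 addrAC subrr add0r; apply: eq_bigr => j _; rewrite ger0_norm //.
  by have := mx_ge0D _ _ _ _ r0 q0 i j; rewrite [X in X <= _]mxE.
have P0 i : 0 <= \sum_j Pm w n i j.
  by apply: sumr_ge0 => j _; have := p0 i j; rewrite mxE.
have le1 : mx_rownorm (Rm w n + Qm w n) <= 1.
  rewrite /mx_rownorm; apply/bigmax_leP; split => // i _.
  by rewrite rowE gerBl.
split.
  by rewrite le1 andbT; exact: bigmax_ge_id.
move=> i Pi; apply/eqP; rewrite eq_le le1 /=.
have := rowE i; rewrite Pi subr0 => <-.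
exact: (le_bigmax _ (fun i => \sum_j `|(Rm w n + Qm w n) i j|)).
Qed.

Hypothesis C2 : forall n : int, (\int[P]_w log_inv_gap (Rm w n + Qm w n)%R < +oo)%E.

(** A vanishing row of P makes the integrand of (C2) infinite. *)
Lemma ae_rows_gt0 : {ae P, forall w : Omega R d, forall n i, 0 < \sum_j Pm w n i j}.
Proof.
have Hn (n : int) : {ae P, forall w : Omega R d, forall i, 0 < \sum_j Pm w n i j}.
  pose N := \bigcup_(i in [set: 'I_d.+1]) [set w : Omega R d | \sum_j Pm w n i j <= 0].
  have mN : measurable N.
    apply: fin_bigcup_measurable => [|i _]; first exact: finite_finset.
    have mf : measurable_fun setT (fun w : Omega R d => \sum_j Pm w n i j).
      by apply: measurable_sum => j; exact: measurable_Pm.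
    have := mf measurableT `]-oo, 0]%classic (measurable_itv _).
    by rewrite setTI; congr measurable; apply/seteqP; split => w /=; rewrite in_itv.
  exists N; split => //.
    apply: (ae_not_infty _ _ R P (fun w => log_inv_gap (Rm w n + Qm w n)%R) N) => //.
    - move=> w; have [/andP[n0 n1] _] := rownorm_RQ w n.
      rewrite /log_inv_gap lne_ge0; set x := 1 - _.
      have x0 : 0 <= x by rewrite subr_ge0.
      have x1 : x <= 1 by rewrite gerBl.
      have [->|xN0] := eqVneq x 0; first by rewrite /inve eqxx leey.
      rewrite /inve (negbTE xN0) lee_fin invf_ge1 // lt_neqAle eq_sym xN0 //.
    - move=> w [i _ Pi]; have [_ /(_ i) norm1] := rownorm_RQ w n.
      rewrite /log_inv_gap norm1 ?subrr /inve ?eqxx //.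
      have [p0 _ _ _] := env_ok w n.
      apply/eqP; rewrite eq_le Pi sumr_ge0 // => j _.
      by have := p0 i j; rewrite mxE.
  by move=> w /= /existsNP[i /negP]; rewrite -leNgt => le0; exists i.
have aen : {ae P, forall w : Omega R d, forall m : nat, (forall i, 0 < \sum_j Pm w m%:Z i j)
    /\ (forall i, 0 < \sum_j Pm w (Negz m) i j)}.
  apply: ae_foralln => m; have h1 := Hn m%:Z; have h2 := Hn (Negz m).
  by apply: filterS2 h1 h2.
by apply: filterS aen => w H [] m; case: (H m).
Qed.

End PositiveRows.

(** * Shift covariance of zeta and of the initial law *)

Lemma ae_imply2 disp (T : measurableType disp) (R : realType)
    (m : {measure set T -> \bar R}) (A B C : set T) :
  (forall x, A x -> B x -> C x) ->
  {ae m, forall x, A x} -> {ae m, forall x, B x} -> {ae m, forall x, C x}.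
Proof. by move=> ABC a b; apply: filterS2 a b. Qed.
Arguments ae_imply2 {disp T R m A B C}.

Section StationaryVectors.
Context {R : realType} {d : nat}.
Implicit Types (z : int -> 'M[R]_d.+1) (y : int -> 'rV[R]_d.+1).

Lemma cvg_entry m n (f : nat -> 'M[R]_(m, n)) (A : 'M[R]_(m, n)) i j :
  f @ \oo --> A -> (fun k => f k i j) @ \oo --> A i j.
Proof.
move=> fA; exact: (@cvg_comp _ _ _ f (fun B : 'M[R]_(m, n) => B i j) _ _ _ fA
  (@coord_continuous R m n i j A)).
Qed.

Let u0 : 'rV[R]_d.+1 := delta_mx 0 ord0.

Let u0_prob : prob_row u0.
Proof.
split=> [i|]; first by rewrite mxE ler0n.
rewrite (bigD1 ord0) //= mxE !eqxx big1 ?addr0 // => i i0.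
by rewrite mxE (negbTE i0) andbF.
Qed.

Lemma is_y_entry z y n i : is_y z y ->
  (fun m : nat => (u0 *m \prod_(l < m.+1) z (n - m%:Z + l%:Z)) 0 i) @ \oo --> y n 0 i.
Proof. by move=> yP; apply: cvg_entry; exact: (yP n (fun=> u0) (fun=> u0_prob)). Qed.

(** Limits of the same products, indexed differently; any initial vector will do,
    and [u0] is constant in the layer. *)
Lemma is_y_shift z y y' k : is_y z y -> is_y (fun n => z (n + k)) y' ->
  forall n, y' n = y (n + k).
Proof.
move=> yP y'P n; apply/rowP => i.
have h1 := is_y_entry _ _ n i y'P; have h2 := is_y_entry _ _ (n + k) i yP.
apply: (cvg_unique _ h1); first exact: Rhausdorff.
rewrite (_ : (fun m : nat => _) = (fun m : nat =>
  (u0 *m \prod_(l < m.+1) z (n + k - m%:Z + l%:Z)) 0 i)) //.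
apply/funext => m; congr ((_ *m _) _ _); apply: eq_bigr => l _.
by congr z; lia.
Qed.

Lemma is_yS z y n : is_y z y -> y (n + 1) = y n *m z (n + 1).
Proof.
move=> yP; apply/rowP => i.
have h := is_y_entry _ _ (n + 1) i yP; rewrite -cvg_shiftS /= in h.
apply: (cvg_unique _ h); first exact: Rhausdorff.
rewrite mxE (_ : (fun m : nat => _) = (fun m : nat => \sum_j
  (u0 *m \prod_(l < m.+1) z (n - m%:Z + l%:Z)) 0 j * z (n + 1) j i)).
  by apply: cvgr_sum => j; apply: cvgMl; exact: is_y_entry.
apply/funext => m; rewrite big_ord_recr /= mulmxA mxE; apply: eq_bigr => j _.
congr (_ * _); last by congr (z _ _ _); lia.
congr ((_ *m _) _ _); apply: eq_bigr => l _.
by congr z; lia.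
Qed.

Lemma is_y_prod z y k : is_y z y -> y (- 1 + k%:Z) = y (- 1) *m \prod_(l < k) z l%:Z.
Proof.
move=> yP; elim: k => [|k IH]; first by rewrite big_ord0 mulmx1 addr0.
have -> : - 1 + k.+1%:Z = (- 1 + k%:Z) + 1 by lia.
rewrite (is_yS _ _ _ yP) IH big_ord_recr /= -mulmxA; congr (_ *m (_ *m z _)).
lia.
Qed.

End StationaryVectors.

Section Environment.
Variables (R : realType) (d : nat) (P : probability (Omega R d) R).
Hypothesis (Pstat : stationary P) (PC : conditionC P).
Variable zeta : Omega R d -> int -> 'M[R]_d.+1.
Hypothesis zetaP : {ae P, forall w, is_zeta w (zeta w)}.
Variable y : Omega R d -> int -> 'rV[R]_d.+1.
Hypothesis yP : {ae P, forall w, is_y (zeta w) (y w)}.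
Variable mu : Omega R d -> 'rV[R]_d.+1.
Hypothesis mu_prob : forall w, prob_row (mu w).
Hypothesis mu_y : {ae P, forall w, mu w = y w (- 1)}.
Variable Pq : R.-pker (Omega R d) ~> (Traj d).
Hypothesis PqP : forall w, quenched_law w (mu w) (Pq w).
Variable PP : probability (Omega R d * Traj d)%type R.
Hypothesis PPP : annealed_law P Pq PP.
Hypothesis transient : transient_right PP.

Lemma Pq1 w : Pq w setT = 1%E. Proof. exact: prob_kernel. Qed.

Lemma measurable_Pq (A : set (Traj d)) : measurable A ->
  measurable_fun setT (fun w => Pq w A).
Proof. by move=> mA; exact: measurable_kernel. Qed.

Lemma measurable_mu : measurable_mx 1 d.+1 mu.
Proof.
move=> a i; rewrite ord1; apply/measurable_EFinP.
have mC := measurable_cyl (fun=> (0 : int, i)) 0.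
have := measurable_Pq _ mC; congr (measurable_fun _ _); apply/funext => w.
by rewrite /cyl PqP /init /= big_ord0 mulr1.
Qed.

Lemma annealed_setT (A : set (Traj d)) : measurable A ->
  PP (setT `*` A) = (\int[P]_w Pq w A)%E.
Proof. by move=> mA; rewrite PPP. Qed.

(** A trajectory which tends to +oo does not stay below layer k+1; the annealed
    statement becomes quenched because its probability is an integral over P. *)
Lemma ae_escapes : {ae P, forall w, forall k : nat,
  (fun n => (mu w *m surv w k.+1%:Z n k) 0 0) @ \oo --> (0 : R)}.
Proof.
apply: ae_foralln => k.
pose E n : set (Traj d) := alive_until (fun p => p < k.+1%:Z) xpredT 0 n.
have mE n : measurable (E n) by exact: measurable_alive_until.
have mD : measurable (\bigcap_n E n) by exact: bigcapT_measurable.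
have D0 : PP (setT `*` \bigcap_n E n) = 0%E.
  apply: measure_negligible; first exact: measurableX.
  apply: negligibleS transient => -[w x] /= [_ xD] xoo.
  have := (cvgryPge _).1 xoo k.+1%:R.
  move=> [N _ /(_ N (leqnn N))] /=; apply/negP; rewrite -ltNge.
  have [/(_ N) + _] := xD N I; rewrite add0n leqnn /= => /(_ isT).
  by rewrite /xi -(ltr_int R).
have : {ae P, forall w, Pq w (\bigcap_n E n) = 0%E}.
  have mf := measurable_Pq _ mD.
  have : (\int[P]_w `|Pq w (\bigcap_n E n)| = 0)%E.
    by rewrite -D0 annealed_setT //; apply: eq_integral => w _; rewrite gee0_abs.
  move/(ae_eq_integral_abs _ measurableT mf).1.
  by apply: filterS => w; apply.
apply: filterS => w D0w.
have : Pq w (E n) @[n --> \oo] --> Pq w (\bigcap_n E n).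
  apply: nonincreasing_cvg_mu => //.
    by rewrite ltey_eq law_fin_num //; exact: Pq1.
  apply/nonincreasing_seqP => n; rewrite subsetEset => x /= [al _]; split => //.
  by move=> l /andP[l0 ln]; apply: al; rewrite l0 (leq_trans ln).
rewrite D0w.
under eq_fun do rewrite /E (law_survival _ _ _ (PqP w) (Pq1 w) (mu_prob w)).
by move/fine_cvgP => [_] /=.
Qed.

Lemma surv_cvg0_of_mu w (k : nat) i : 0 < mu w 0 i ->
  (fun n => (mu w *m surv w k.+1%:Z n k) 0 0) @ \oo --> (0 : R) ->
  (fun n => surv w k.+1%:Z n k i 0) @ \oo --> (0 : R).
Proof.
move=> mi h.
apply: (@squeeze_cvgr _ _ _ _ (fun=> 0)
  (fun n => (mu w 0 i)^-1 * (mu w *m surv w k.+1%:Z n k) 0 0)).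
- near=> n; rewrite surv_ge0 /= ler_pdivlMl // [leRHS]mxE (bigD1 i) //= lerDl.
  by apply: sumr_ge0 => j _; rewrite mulr_ge0 ?surv_ge0 //; case: (mu_prob w).
- exact: cvg_cst.
- by rewrite -[X in _ --> X](mulr0 (mu w 0 i)^-1); apply: cvgMr.
Unshelve. all: by end_near.
Qed.

Lemma ae_entered_from_left : {ae P, forall w, entered_from_left w}.
Proof.
have H (j : 'I_d.+1) : {ae P, forall w : Omega R d, forall n, 0 < \sum_i Pm w n i j}.
  have aen : {ae P, forall w : Omega R d, forall m : nat, 0 < \sum_i Pm w m%:Z i j
      /\ 0 < \sum_i Pm w (Negz m) i j}.
    apply: ae_foralln => m; have h1 := C3 PC j m%:Z; have h2 := C3 PC j (Negz m).
    apply: ae_imply2 h1 h2; by move=> w [_ ?] [_ ?].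
  by apply: filterS aen => w h [] m; case: (h m).
have aen : {ae P, forall w : Omega R d, forall (m : nat) n, 0 < \sum_i Pm w n i (inord m)}.
  by apply: ae_foralln => m; exact: H.
by apply: filterS aen => w h n j; rewrite -(inord_val j).
Qed.

(** True on the event of (C4), by communication with a state charged by the
    initial law; inherited by the shifted environment; hence almost sure. *)
Lemma ae_hits_right : {ae P, forall w, hits_right w}.
Proof.
pose A := [set w : Omega R d | hits_right w /\ entered_from_left w].
have mA : measurable A.
  by apply: measurableI; [exact: measurable_hits_right|exact: measurable_entered_from_left].
have C4A : {ae P, forall w, layer0_one_class w -> A w}.
  apply: ae_imply2 ae_entered_from_left ae_escapes => w wr we w1; split => //.
  have [i mi] : exists i, 0 < mu w 0 i.
    apply/not_existsP => H; have [_] := mu_prob w.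
    move/eqP; rewrite lt_eqF //; apply: le_lt_trans ltr01.
    by apply: sumr_le0 => i _; rewrite leNgt; apply/negP; exact: H.
  apply/hits_rightP => j; apply: reaches_leads_to (w1 i j) _ => c.
  have E0 : layer_at `|c|.+1%:Z `|c|%N = 0 by rewrite /layer_at; lia.
  apply: (@reaches_le _ _ _ _ `|c|.+1%:Z); first by lia.
  rewrite /reaches -E0; under eq_fun do rewrite stay_below_surv.
  exact: surv_cvg0_of_mu.
have A0 : (0 < P A)%E.
  rewrite lt_def measure_ge0 andbT; apply/eqP => PA0.
  have := C4 PC; rewrite lt_def => /andP[/eqP + _]; apply.
  apply: measure_negligible; first exact: measurable_layer0_one_class.
  have nA : P.-negligible A by apply/negligibleP.
  apply: negligibleS (negligibleU nA C4A) => w /= w1.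
  by have [?|?] := pselect (A w); [left|right => H; have := H w1].
have PA1 : P A = 1%E.
  apply: ergodic_forward_invariant => //; first exact: (C1 PC).
  move=> w [h r]; split; first exact: hits_right_theta1.
  by move=> n j; exact: r.
exists (~` A); split; first exact: measurableC.
  by rewrite probability_setC // PA1 subee.
by move=> w /= nh [].
Qed.

(** Both zeta(theta^k w) and the shift of zeta(w) solve the hitting equation in
    theta^k w, where the solution is unique. *)
Lemma ae_zeta_theta : {ae P, forall w, forall k : int,
  is_zeta w (zeta w) /\ zeta (theta k w) = (fun n => zeta w (n + k))}.
Proof.
have h1 := ae_all_theta _ Pstat _ ae_hits_right.
have h2 := ae_all_theta _ Pstat _ zetaP.
apply: ae_imply2 h1 h2 => w hr zz k.
have z0 : is_zeta w (zeta w) by have := zz 0; rewrite theta0.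
split => //; apply: (is_zeta_unique (theta k w)) => //.
- exact: is_zeta_shift.
- by apply: hits_right_all_layers => l; rewrite theta_add.
Qed.

Lemma ae_mu_theta : {ae P, forall w, forall k : nat,
  mu (theta k%:Z w) = mu w *m \prod_(l < k) zeta w l%:Z}.
Proof.
have h1 := ae_all_theta _ Pstat _ yP.
have h2 := ae_all_theta _ Pstat _ mu_y.
have h3 := ae_zeta_theta.
have h12 : {ae P, forall w, (forall k, is_y (zeta (theta k w)) (y (theta k w))) /\
    (forall k : int, mu (theta k w) = y (theta k w) (- 1))}.
  by apply: ae_imply2 h1 h2.
apply: ae_imply2 h12 h3 => w [yy mm] zz k.
have y0 : is_y (zeta w) (y w) by have := yy 0; rewrite theta0.
have m0 : mu w = y w (- 1) by have := mm 0; rewrite theta0.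
have [_ zk] := zz k%:Z.
rewrite mm m0 -is_y_prod //.
by apply: is_y_shift y0 _ _; rewrite -zk.
Qed.

Definition visit (p : int) (i : 'I_d.+1) (n : nat) : set (Traj d) :=
  alive_until (fun q => q != 1) (pred1 (p, i)) 0 n.

Definition visits (k : nat) (i : 'I_d.+1) (w : Omega R d) : \bar R :=
  (\sum_(0 <= n <oo) Pq w (visit (- k%:Z)%R i n))%E.

(** The walk lives in theta^k w but the Green function is written with the shift
    of zeta(w), a solution there as well; so all factors depend on w alone. *)
Lemma ae_visits_theta : {ae P, forall w, forall k i,
  visits k i (theta k%:Z w) = ((mu w *m series_term w (zeta w) k) 0 i)%:E /\
  (forall j, 0 <= series_term w (zeta w) k j i)}.
Proof.
have h1 := ae_all_theta _ Pstat _ ae_escapes.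
have h2 := ae_all_theta _ Pstat _ (ae_rows_gt0 _ (fun n => (C2 PC n).2)).
have h12 : {ae P, forall w, forall k : int, (forall k0 : nat,
   (fun n => (mu (theta k w) *m surv (theta k w) k0.+1%:Z n k0) 0 0) @ \oo --> (0 : R)) /\
   (forall n i, 0 < \sum_j Pm (theta k w) n i j)}.
  by apply: ae_imply2 h1 h2; move=> w a b k; split.
have h34 : {ae P, forall w, (forall k : int,
  is_zeta w (zeta w) /\ zeta (theta k w) = (fun n => zeta w (n + k))) /\
   forall k : nat, mu (theta k%:Z w) = mu w *m \prod_(l < k) zeta w l%:Z}.
  by apply: ae_imply2 ae_zeta_theta ae_mu_theta.
apply: ae_imply2 h12 h34 => w esc [zz mm] k i.
have [zw _] := zz 0.
have zk := is_zeta_shift _ _ k%:Z zw.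
have [esck rows] := esc k%:Z.
split.
  rewrite /visits /visit; under eq_eseriesr do
    rewrite (law_occupation _ _ _ (PqP _) (Pq1 _) (mu_prob _)).
  apply: cvg_lim => //; under eq_fun do rewrite big_mkord sumEFin.
  apply/fine_cvgP; split; first by near=> n.
  have := occ_series _ _ _ k i zk (mu_prob (theta k%:Z w)) rows (esck 0%N).
  by rewrite green_row_shift mm /series_term !mulmxA.
move=> j; have P0 n l : 0 < \sum_m Pm w n l m.
  by have := rows (n - k%:Z) l; rewrite Pm_shift subrK.
by have := series_term_ge0 _ _ k zw P0 j i; rewrite [X in X <= _]mxE.
Unshelve. all: by end_near.
Qed.

End Environment.

(** * The hitting time as a series *)

Section HittingTime.
Context {R : realType} {d : nat}.
Implicit Types x : Traj d.
Local Open Scope ereal_scope.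

Lemma lt_T1 x n :
  ((n%:R)%:E < T1 R x) <-> forall l, (l <= n)%N -> xi x l != 1%R.
Proof.
split=> [nT l ln|H].
  apply/eqP => E; move: nT; rewrite ltNge => /negP; apply.
  apply: (@le_trans _ _ (l%:R)%:E); last by rewrite lee_fin ler_nat.
  by apply: ereal_inf_lbound; exists l.
apply: (@lt_le_trans _ _ (n.+1%:R)%:E); first by rewrite lte_fin ltr_nat.
apply: le_ereal_inf_tmp => _ [t /= xt <-]; rewrite lee_fin ler_nat ltnNge.
by apply/negP => /H; rewrite xt eqxx.
Qed.

(** The instants before T_1 are 0, ..., t-1 if t is the first time at layer 1, and
    all natural numbers if layer 1 is never reached. *)
Lemma T1_series x : T1 R x = \sum_(0 <= n <oo | (n%:R)%:E < T1 R x) 1.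
Proof.
have [[t xt]|H] := pselect (exists t, xi x t = 1%R); last first.
  have T1oo : T1 R x = +oo.
    rewrite /T1 (_ : [set _ | _ in _] = set0) ?ereal_inf0 //.
    by rewrite -subset0 => _ [t /= xt _]; apply: H; exists t.
  rewrite [LHS]T1oo; apply/esym/cvg_lim => //.
  under eq_fun => N.
    rewrite (eq_bigl xpredT); last by move=> n; rewrite T1oo ltry.
    rewrite big_mkord sumEFin sumr_const card_ord; over.
  by apply/cvgeryP; exact: cvgr_idn.
have xt' : exists t, xi x t == 1%R by exists t; apply/eqP.
case: (ex_minnP xt') => {xt'}t {}xt tmin.
have ltE n : ((n%:R)%:E < T1 R x) = (n < t)%N.
  apply/idP/idP => [/lt_T1 nT|nt].
    by rewrite ltnNge; apply/negP => /nT; rewrite xt.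
  apply/lt_T1 => l ln; apply/negP => /tmin tl.
  by have := leq_trans (leq_ltn_trans ln nt) tl; rewrite ltnn.
have T1t : T1 R x = (t%:R)%:E.
  apply/eqP; rewrite eq_le; apply/andP; split.
    by apply: ereal_inf_lbound; exists t => //=; apply/eqP.
  apply: le_ereal_inf_tmp => _ [u /= xu <-]; rewrite lee_fin ler_nat.
  by apply: tmin; apply/eqP.
rewrite [LHS]T1t; apply/esym/cvg_lim => //; apply: cvg_near_cst; near=> N.
under eq_bigl do rewrite ltE.
have tN : (t <= N)%N by near: N; exact: nbhs_infty_ge.
rewrite -(big_nat_widen 0 t N xpredT _ tN) big_mkord sumEFin sumr_const card_ord.
by [].
Unshelve. all: by end_near.
Qed.

End HittingTime.

(** * The measures Q_i as integrals over the environment *)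

Section OccupationMeasure.
Variables (R : realType) (d : nat) (P : probability (Omega R d) R).
Hypothesis Pstat : stationary P.
Variable mu : Omega R d -> 'rV[R]_d.+1.
Hypothesis mu_prob : forall w, prob_row (mu w).
Variable Pq : R.-pker (Omega R d) ~> (Traj d).
Hypothesis PqP : forall w, quenched_law w (mu w) (Pq w).
Variable PP : probability (Omega R d * Traj d)%type R.
Hypothesis PPP : annealed_law P Pq PP.

Definition seen_at (i : 'I_d.+1) (B : set (Omega R d)) (n : nat) :
    set (Omega R d * Traj d) :=
  [set wx | [/\ forall l, (l <= n)%N -> xi wx.2 l != 1,
                B (theta (xi wx.2 n) wx.1) & Y wx.2 n = i]].

Lemma Qi_summand (i : 'I_d.+1) B (wx : Omega R d * Traj d) :
  (\sum_(0 <= n <oo | (n%:R)%:E < T1 R wx.2)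
      (\1_B (theta (xi wx.2 n) wx.1) * (Y wx.2 n == i)%:R : R)%:E =
   \sum_(0 <= n <oo) (\1_(seen_at i B n) wx : R)%:E)%E.
Proof.
rewrite eseries_mkcond; apply: eq_eseriesr => n _; rewrite !indicE.
case: (boolP (wx \in seen_at i B n)) => [/set_mem[/lt_T1 -> Bw ->]|nU].
  by rewrite mem_set // eqxx mulr1.
case: ifPn => // /lt_T1 al; congr (_%:E).
have [YE|_] := eqVneq (Y wx.2 n) i; last by rewrite mulr0.
rewrite memNset ?mul0r // => Bw; move/negP: nU; apply.
exact: mem_set.
Qed.

Lemma seen_atE i B n : seen_at i B n =
  (\bigcup_k ((theta (- k%:Z) @^-1` B) `*` visit d (- k%:Z) i n)) `|`
  (\bigcup_k ((theta k.+1%:Z @^-1` B) `*` visit d k.+1%:Z i n)).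
Proof.
apply/seteqP; split=> [[w x] /= [al Bw Yi]|[w x] /=].
  have vis : visit d (xi x n) i n x.
    split=> /=; first by move=> l; exact: al.
    by apply/eqP; rewrite add0n /xi -Yi /Y; exact: surjective_pairing.
  case: (lerP (xi x n) 0) => xn; [left|right].
    by exists `|xi x n|%N => //; have -> : - `|xi x n|%N%:Z = xi x n by lia.
  by exists `|xi x n|.-1 => //; have -> : `|xi x n|.-1.+1%:Z = xi x n by lia.
by move=> [|] [k _ [/= Bw [al]]]; rewrite /= add0n => /eqP xn;
  (split; [by move=> l ln; exact: al|by rewrite /xi /= xn|by rewrite /Y /= xn]).
Qed.

Lemma measurable_theta_preimage k (B : set (Omega R d)) :
  measurable B -> measurable (theta k @^-1` B).
Proof. by move=> mB; rewrite -[X in measurable X]setTI; exact: measurable_theta. Qed.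

Lemma measurable_visit p i n : measurable (visit d p i n).
Proof. exact: measurable_alive_until. Qed.

Lemma measurable_seen_at i B n : measurable B -> measurable (seen_at i B n).
Proof.
move=> mB; rewrite seen_atE; apply: measurableU; apply: bigcupT_measurable => k;
  (apply: measurableX; [exact: measurable_theta_preimage|exact: measurable_visit]).
Qed.

(** Splits the visit according to the layer; layers from 1 on have probability
    zero. *)
Lemma PP_seen_at i B n : measurable B ->
  (PP (seen_at i B n) =
   \sum_(0 <= k <oo) \int[P]_(w in theta (- k%:Z)%R @^-1` B) Pq w (visit d (- k%:Z)%R i n))%E.
Proof.
move=> mB; rewrite seen_atE.
have mr p : measurable ((theta p @^-1` B) `*` visit d p i n).
  by apply: measurableX; [exact: measurable_theta_preimage|exact: measurable_visit].
have PPr p : PP ((theta p @^-1` B) `*` visit d p i n) =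
    (\int[P]_(w in theta p @^-1` B) Pq w (visit d p i n))%E.
  by apply: PPP; [exact: measurable_theta_preimage|exact: measurable_visit].
rewrite measureU0; first last.
- apply: measure_negligible; first exact: bigcupT_measurable.
  apply: negligible_bigcup => k; apply/negligibleP => //.
  apply: etrans (PPr _) _; apply: integral0_eq => w _.
  by rewrite /visit (law_above _ _ _ (PqP w)) //; exact: prob_kernel.
- exact: bigcupT_measurable.
- exact: bigcupT_measurable.
rewrite measure_semi_bigcup //; first last.
- exact: bigcupT_measurable.
- move=> k k' _ _ [[w x] /= [[_ [_ /= /eqP e1]] [_ [_ /= /eqP e2]]]].
  by move: e2; rewrite e1 => -[]; lia.
by apply: eq_eseriesr => k _; exact: PPr.
Qed.

Lemma measurable_visits k i : measurable_fun setT (visits R d Pq k i).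
Proof.
apply: (@ge0_emeasurable_sum _ _ _ _ _ xpredT) => // n _.
exact: measurable_kernel _ _ (measurable_visit _ _ _).
Qed.

Lemma visits_ge0 k i w : (0 <= visits R d Pq k i w)%E.
Proof. by apply: nneseries_ge0 => n _ _; exact: measure_ge0. Qed.

(** The density of Q_i / v_p, before its identification with the series. *)
Definition density (i : 'I_d.+1) (w : Omega R d) : \bar R :=
  (\sum_(0 <= k <oo) visits R d Pq k i (theta k%:Z w))%E.

Lemma density_ge0 i w : (0 <= density i w)%E.
Proof. by apply: nneseries_ge0 => k _ _; exact: visits_ge0. Qed.

Lemma measurable_visits_theta k i :
  measurable_fun setT (fun w => visits R d Pq k i (theta k%:Z w)).
Proof. exact: (measurableT_comp (measurable_visits k i) (measurable_theta k%:Z)). Qed.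

Lemma measurable_density i : measurable_fun setT (density i).
Proof.
apply: (@ge0_emeasurable_sum _ _ _ _ _ xpredT) => [k w _ _|k _].
  exact: visits_ge0.
exact: measurable_visits_theta.
Qed.

(** A walker at layer -k of w sees theta^(-k) w.  Writing w = theta^k w', which
    preserves P, makes w' the environment seen, while the walk lives in
    theta^k w'. *)
Lemma integral_seen_at i B : measurable B ->
  (\int[PP]_wx \sum_(0 <= n <oo) (\1_(seen_at i B n) wx : R)%:E =
   \int[P]_(w in B) density i w)%E.
Proof.
move=> mB; rewrite integral_nneseries //; first last.
- by move=> n; apply/measurable_EFinP; apply: measurable_indic; exact: measurable_seen_at.
rewrite (eq_eseriesr (g := fun n => \sum_(0 <= k <oo)
    \int[P]_(w in theta (- k%:Z)%R @^-1` B) Pq w (visit d (- k%:Z)%R i n))%E); last first.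
  move=> n _; rewrite -PP_seen_at // integral_indic ?setIT //.
  exact: measurable_seen_at.
rewrite nneseries_interchange; last first.
  by move=> n k; apply: integral_ge0 => w _; exact: measure_ge0.
rewrite /density integral_nneseries //; first last.
- by move=> k w _; exact: visits_ge0.
- by move=> k; apply: measurable_funTS; exact: measurable_visits_theta.
apply: eq_eseriesr => k _.
rewrite -integral_nneseries //; first last.
- by move=> n; apply: measurable_funTS; exact: measurable_kernel _ _ (measurable_visit _ _ _).
- exact: measurable_theta_preimage.
rewrite -[LHS]/(\int[P]_(w in theta (- k%:Z)%R @^-1` B) visits R d Pq k i w)%E.
rewrite [LHS]integral_mkcond [LHS](integral_theta _ Pstat k%:Z); first last.
- by move=> w; apply: erestrict_ge0 => {}w _; exact: visits_ge0.
- have mD := measurable_theta_preimage (- k%:Z) B mB.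
  apply: (measurable_restrictT _ mD).1.
  by apply: measurable_funTS; exact: measurable_visits.
rewrite [RHS]integral_mkcond; apply: eq_integral => w _.
rewrite /patch; congr (if _ then _ else _).
apply/idP/idP => /set_mem.
  by rewrite /preimage /= theta_add addNr theta0 => ?; exact: mem_set.
by move=> Bw; apply/mem_set; rewrite /preimage /= theta_add addNr theta0.
Qed.

Lemma QiE i B : measurable B ->
  Qi PP i B = (vp PP * \int[P]_(w in B) density i w)%E.
Proof.
move=> mB; rewrite /Qi -integral_seen_at //; congr (_ * _)%E.
by apply: eq_integral => wx _; rewrite Qi_summand.
Qed.

End OccupationMeasure.

(** * Integrability of T_1 *)

Section Speed.
Variables (R : realType) (d : nat) (P : probability (Omega R d) R).
Variable mu : Omega R d -> 'rV[R]_d.+1.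
Hypothesis mu_prob : forall w, prob_row (mu w).
Variable Pq : R.-pker (Omega R d) ~> (Traj d).
Hypothesis PqP : forall w, quenched_law w (mu w) (Pq w).
Variable PP : probability (Omega R d * Traj d)%type R.
Hypothesis PPP : annealed_law P Pq PP.
Local Open Scope ereal_scope.

Let alive n : set (Omega R d * Traj d) :=
  setT `*` alive_until (fun q => q != 1%R) xpredT 0 n.

Let measurable_alive n : measurable (alive n).
Proof. by apply: measurableX => //; exact: measurable_alive_until. Qed.

Let T1_alive (wx : Omega R d * Traj d) :
  T1 R wx.2 = \sum_(0 <= n <oo) (\1_(alive n) wx : R)%:E.
Proof.
rewrite T1_series eseries_mkcond; apply: eq_eseriesr => n _; rewrite indicE.
case: ifPn => [/lt_T1 al|/negP nal].
  by rewrite mem_set //; split => //; split => // l; exact: al.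
by rewrite memNset // => -[_ [al _]]; apply: nal; apply/lt_T1 => l ln; exact: al.
Qed.

Lemma measurable_T1 : measurable_fun setT (fun wx : Omega R d * Traj d => T1 R wx.2).
Proof.
rewrite (_ : (fun _ => _) = fun wx => \sum_(0 <= n <oo) (\1_(alive n) wx : R)%:E).
  apply: (@ge0_emeasurable_sum _ _ _ _ _ xpredT) => [n wx _ _|n _].
    by rewrite lee_fin.
  by apply/measurable_EFinP; exact: measurable_indic.
by apply/funext => wx; exact: T1_alive.
Qed.

Lemma integral_T1_ge1 : 1 <= \int[PP]_wx T1 R wx.2.
Proof.
have PP1 : PP (alive 0) = 1.
  rewrite PPP //; last exact: measurable_alive_until.
  rewrite (eq_integral (cst 1)) => [|w _].
    by rewrite integral_cst // mul1e; exact: probability_setT.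
  rewrite (law_start _ _ _ (PqP w) (prob_kernel w) (mu_prob w)) /=.
  rewrite (eq_bigr (fun i => mu w 0%R i)) => [|i _]; last by rewrite mulr1.
  by rewrite (mu_prob w).2.
have <- : \int[PP]_wx (\1_(alive 0) wx : R)%:E = 1.
  by rewrite integral_indic ?setIT.
apply: ge0_le_integral => //.
- by apply/measurable_EFinP; exact: measurable_indic.
- exact: measurable_T1.
- move=> wx _; rewrite T1_alive.
  apply: le_trans (nneseries_lim_ge 1%N _) => [|n _ _]; last by rewrite lee_fin.
  by rewrite big_nat1.
Qed.

Lemma vp_fin : 0 < vp PP -> exists r : R,
  [/\ (0 < r)%R, \int[PP]_wx T1 R wx.2 = r%:E & vp PP = (r^-1)%:E].
Proof.
rewrite /vp; have := integral_T1_ge1.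
case: (\int[PP]_wx T1 R wx.2) => [r| |] // r1 v0; last by rewrite /inve ltxx in v0.
have r0 : (0 < r)%R by rewrite -lte_fin (lt_le_trans _ r1).
by exists r; split => //; rewrite /inve gt_eqF.
Qed.

Lemma seen_at_le_T1 i B (wx : Omega R d * Traj d) :
  \sum_(0 <= n <oo) (\1_(seen_at R d i B n) wx : R)%:E <= T1 R wx.2.
Proof.
rewrite T1_alive; apply: lee_nneseries => [n _ _|n _]; rewrite !lee_fin //.
rewrite !indicE; case: (boolP (wx \in seen_at R d i B n)) => // /set_mem[al _ _].
by rewrite mem_set //; split => //; split => // l; exact: al.
Qed.

End Speed.

(** * The densities *)

Section Series.
Variables (R : realType) (d : nat).
Local Open Scope ereal_scope.

(** Measurability holds everywhere, including where the series of entries diverges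
    or an inverse does not exist. *)
Lemma measurable_mu_series (mu : Omega R d -> 'rV[R]_d.+1)
    (zeta : Omega R d -> int -> 'M[R]_d.+1) i :
  measurable_mx 1 d.+1 mu ->
  (forall n, measurable_mx d.+1 d.+1 (fun w => zeta w n)) ->
  measurable_fun setT (fun w => mu_series (mu w) w (zeta w) i).
Proof.
move=> mmu mzeta.
have mU n : measurable_mx d.+1 d.+1 (fun w => utilde w (zeta w) n).
  apply: measurable_invmx; apply: measurable_mxB; last exact: measurable_Rm.
  apply: measurable_mxB; first exact: measurable_mx_cst.
  by apply: measurable_mxM => //; exact: measurable_Qm.
have mA n : measurable_mx d.+1 d.+1 (fun w => Amx w (zeta w) n).
  by apply: measurable_mxM => //; exact: measurable_Qm.
have mterm k : measurable_mx d.+1 d.+1 (fun w => series_term w (zeta w) k).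
  apply: measurable_mxM => //; apply: measurable_mxM.
    exact: (measurable_mx_prod _ _ (fun l w => zeta w l%:Z)).
  exact: (measurable_mx_prod _ _ (fun l w => Amx w (zeta w) (k%:Z - l%:Z)%R)).
apply: emeasurable_sum => j; apply: emeasurable_funM.
  by apply/measurable_EFinP; exact: mmu.
apply: (measurable_limn (fun N w => \sum_(0 <= k < N) (series_term w (zeta w) k j i)%:E)) => N.
apply: emeasurable_sum => k.
by apply/measurable_EFinP; exact: mterm.
Qed.

Lemma mu_seriesE (m : 'rV[R]_d.+1) w z i :
  (forall j, (0 <= m 0%R j)%R) -> (forall k j, (0 <= series_term w z k j i)%R) ->
  mu_series m w z i = \sum_(0 <= k <oo) ((m *m series_term w z k) 0%R i)%:E.
Proof.
move=> m0 t0; rewrite /mu_series /series_mx.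
rewrite (eq_bigr (fun j => \sum_(0 <= k <oo)
    ((m 0%R j)%:E * (series_term w z k j i)%:E))) => [|j _]; last first.
  by rewrite nneseriesZl // => k _; rewrite lee_fin.
rewrite -nneseries_sum; last by move=> j k _; rewrite -EFinM lee_fin mulr_ge0.
apply: eq_eseriesr => k _; rewrite mxE -sumEFin.
by apply: eq_bigr => j _; rewrite EFinM.
Qed.

End Series.

(** The formula of the theorem is only almost everywhere a convergent series of
    non-negative terms, so integrals are computed with another version g. *)
Lemma has_density_ae disp (T : measurableType disp) (R : realType)
    (m : {measure set T -> \bar R}) (nu : set T -> \bar R) (f g : T -> \bar R) :
  measurable_fun setT f -> measurable_fun setT g -> (forall x, 0 <= g x)%E ->
  {ae m, forall x, f x = g x} ->
  (forall B, measurable B -> nu B = \int[m]_(x in B) g x)%E ->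
  (\int[m]_x g x < +oo)%E -> nu `<< m /\ has_density m nu f.
Proof.
move=> mf mg g0 fg nuE ig.
have nuf B : measurable B -> (nu B = \int[m]_(x in B) f x)%E.
  move=> mB; rewrite nuE //; apply: ae_eq_integral => //; try exact: measurable_funTS.
  by apply: filterS fg => x -> .
split.
  move=> N N0 A mA AN; rewrite nuE //; apply: null_set_integral => //.
    exact: measurable_funTS.
  exact: N0.
split => //; last by apply: filterS fg => x ->.
apply/integrableP; split => //.
rewrite (_ : \int[m]_x `|f x| = \int[m]_x g x)%E //.
apply: ae_eq_integral => //; first exact: measurableT_comp.
by apply: filterS fg => x /= -> _; rewrite gee0_abs.
Qed.

Theorem theorem1p3 (R : realType) (d : nat)
    (P : probability (Omega R d) R)
    (Pstat : stationary P) (PC : conditionC P)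
    (zeta : Omega R d -> int -> 'M[R]_d.+1)
    (zeta_meas : forall (n : int) (i j : 'I_d.+1),
      measurable_fun [set: Omega R d] (fun w => zeta w n i j))
    (zetaP : {ae P, forall w, is_zeta w (zeta w)})
    (y : Omega R d -> int -> 'rV[R]_d.+1)
    (yP : {ae P, forall w, is_y (zeta w) (y w)})
    (mu : Omega R d -> 'rV[R]_d.+1)
    (mu_prob : forall w, prob_row (mu w))
    (mu_y : {ae P, forall w, mu w = y w (- 1)})
    (Pq : R.-pker (Omega R d) ~> (Traj d))
    (PqP : forall w, quenched_law w (mu w) (Pq w))
    (PP : probability (Omega R d * Traj d)%type R)
    (PPP : annealed_law P Pq PP)
    (transient : transient_right PP)
    (vp_gt0 : (0 < vp PP)%E) :
  (forall i : 'I_d.+1,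
     Qi PP i `<< P /\
     has_density P (Qi PP i) (fun w => Lambda_i (vp PP) (mu w) w (zeta w) i)) /\
  (Qbar PP `<< P /\
   has_density P (Qbar PP) (fun w => Lambda (vp PP) (mu w) w (zeta w))).
Proof.
pose D := density R d Pq.
have D0 i w : (0 <= D i w)%E by exact: density_ge0.
have mD i : measurable_fun setT (D i) by exact: measurable_density.
have mmu : measurable_mx 1 d.+1 mu by exact: measurable_mu PqP.
have mS i := measurable_mu_series _ _ mu zeta i mmu zeta_meas.
have SD : {ae P, forall w, forall i, mu_series (mu w) w (zeta w) i = D i w}.
  have := ae_visits_theta R d P Pstat PC zeta zetaP y yP mu mu_prob mu_y Pq PqP PP PPP transient.
  apply: filterS => w H i; rewrite mu_seriesE.
  - by apply: eq_eseriesr => k _; rewrite (H k i).1.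
  - by move=> j; case: (mu_prob w).
  - by move=> k j; exact: (H k i).2.
have [r [r0 iT1 vE]] := vp_fin R d P mu mu_prob Pq PqP PP PPP vp_gt0.
have v0 : (0 <= r^-1%:E)%E by rewrite lee_fin invr_ge0 ltW.
have iD i : (\int[P]_w D i w <= r%:E)%E.
  rewrite -iT1 /D -(integral_seen_at R d P Pstat mu mu_prob Pq PqP PP PPP i setT) //.
  apply: ge0_le_integral => //.
  - by move=> wx _; apply: nneseries_ge0 => n _ _; rewrite lee_fin.
  - apply: (@ge0_emeasurable_sum _ _ _ _ _ xpredT) => [n wx _ _|n _].
      by rewrite lee_fin.
    by apply/measurable_EFinP; apply: measurable_indic; exact: measurable_seen_at.
  - exact: measurable_T1.
  - by move=> wx _; exact: seen_at_le_T1.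
have iDoo i : (\int[P]_w (r^-1%:E * D i w) < +oo)%E.
  rewrite ge0_integralZl //; apply: (@le_lt_trans _ _ (r^-1%:E * r%:E)%E).
    exact: lee_wpmul2l.
  by rewrite -EFinM ltry.
have QiD i B : measurable B -> (Qi PP i B = \int[P]_(w in B) (r^-1%:E * D i w))%E.
  move=> mB; rewrite (QiE R d P Pstat mu mu_prob Pq PqP PP PPP) // vE ge0_integralZl //.
  exact: measurable_funTS.
split=> [i|].
  apply: (has_density_ae _ _ _ P _ _ (fun w => r^-1%:E * D i w)%E) => //.
  - by rewrite /Lambda_i; exact: measurable_funeM.
  - exact: measurable_funeM.
  - by move=> w; exact: mule_ge0.
  - by apply: filterS SD => w H; rewrite /Lambda_i H vE.
  - by move=> B mB; exact: QiD.
apply: (has_density_ae _ _ R P (Qbar PP) (fun w => Lambda (vp PP) (mu w) w (zeta w))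
  (fun w => \sum_(i < d.+1) (r^-1%:E * D i w))%E).
- by rewrite /Lambda; apply: measurable_funeM; exact: emeasurable_sum.
- by apply: emeasurable_sum => i; exact: measurable_funeM.
- by move=> w; apply: sume_ge0 => i _; exact: mule_ge0.
- apply: filterS SD => w H; rewrite /Lambda vE ge0_sume_distrr; last by move=> i _; rewrite H.
  by apply: eq_bigr => i _; rewrite H.
- move=> B mB; rewrite /Qbar ge0_integral_sum //.
  + by apply: eq_bigr => i _; exact: QiD.
  + by move=> i; apply: measurable_funTS; exact: measurable_funeM.
  + by move=> i w _; exact: mule_ge0.
- rewrite ge0_integral_sum //; first last.
  + by move=> i w _; exact: mule_ge0.
  + by move=> i; exact: measurable_funeM.
  by apply: lte_sum_pinfty => i _; exact: iDoo.
Qed.
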